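(* Let $K\ge 2$ be an integer and let $0\le p\le q\le 1$. Then $$\mathscr{H}^{2-q}(E_{\sigma_K}([p,q]))=\begin{cases}1,& q=0,\\ +\infty,& 0<q\le 1,\end{cases}$$ and $$\mathscr{H}^{2-q}(D_{\sigma_K}([p,q]))=\begin{cases}0,& 0\le q<1,\\ +\infty,& q=1.\end{cases}$$
   Context: $\Sigma_K=\{0,\dots,K-1\}^{\mathbb{N}}$ with $\mathbb{N}=\{0,1,2,\dots\}$, endowed with the metric $\rho(x,y)=K^{-\delta(x,y)}$, where $\delta(x,y)=\inf\{i\ge 0:x_i\ne y_i\}$ ($\rho(x,x)=0$). The shift map $\sigma_K:\Sigma_K\to\Sigma_K$ is $(\sigma_K(x))_i=x_{i+1}$. The product $\Sigma_K\times\Sigma_K$ carries the sup metric. For a continuous surjective self-map $f$ of a compact metric space $(X,\rho)$, for $x,y\in X$ and $\epsilon>0$, put $$F_{x,y}(\epsilon)=\liminf_{n\to\infty}\tfrac1n\#\{0\le i<n:\rho(f^i(x),f^i(y))<\epsilon\},\quad F^*_{x,y}(\epsilon)=\limsup_{n\to\infty}\tfrac1n\#\{0\le i<n:\rho(f^i(x),f^i(y))<\epsilon\}.$$ For $0\le p\le q\le1$, $$E_f([p,q])=\{(x,y)\in X\times X:\lim_{\epsilon\to0^+}F^*_{x,y}(\epsilon)=q,\ \lim_{\epsilon\to0^+}F_{x,y}(\epsilon)=p\},$$ $$D_f([p,q])=\{(x,y)\in X\times X:\text{there is }\epsilon_0>0\text{ with }F^*_{x,y}(\epsilon)=q\text{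 and }F_{x,y}(\epsilon)=p\text{ for all }\epsilon\in(0,\epsilon_0]\}.$$ $\mathscr{H}^s$ is the $s$-dimensional Hausdorff measure with no normalizing constant: $\mathscr{H}^s(A)=\lim_{\delta\to0^+}\inf\sum_i|A_i|^s$, the infimum over countable covers $(A_i)$ of $A$ with $\sup_i|A_i|<\delta$, where $|\cdot|$ denotes diameter. *)

(* Defs.v *)
From HB Require Import structures.
From mathcomp Require Import all_boot all_order all_algebra.
From mathcomp Require Import all_classical all_reals all_analysis.

Set Implicit Arguments.
Unset Strict Implicit.
Unset Printing Implicit Defensive.

Import Order.TTheory GRing.Theory Num.Theory.
Import numFieldNormedType.Exports.

Local Open Scope classical_set_scope.
Local Open Scope ring_scope.

Section ProductMetric.
Context {R : realFieldType} {T U : metricType R}.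

Let dist (z w : T * U) : R := Num.max (mdist z.1 w.1) (mdist z.2 w.2).

Let dist_ge0 z w : 0 <= dist z w.
Proof. by rewrite /dist le_max mdist_ge0. Qed.

Let dist_positivity z w : dist z w = 0 -> z = w.
Proof.
case: z w => [x y] [x' y']; rewrite /dist /= => d0.
have : Num.max (mdist x x') (mdist y y') <= 0 by rewrite d0.
rewrite ge_max => /andP[dx dy].
have /mdist_positivity -> : mdist x x' = 0 by apply/le_anti; rewrite dx mdist_ge0.
suff /mdist_positivity -> : mdist y y' = 0 by [].
by apply/le_anti; rewrite dy mdist_ge0.
Qed.

Let ballEdist z d : ball z d = [set w | dist z w < d].
Proof.
apply/seteqP; split => w; rewrite /ball /= /prod_ball !ballEmdist /dist /= gt_max.
  by case=> -> ->.
by case/andP.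
Qed.

(* Sup metric; its balls are those of the library's product pseudometric. *)
HB.instance Definition _ :=
  PseudoMetric_isMetric.Build R (T * U)%type dist_ge0 dist_positivity ballEdist.

End ProductMetric.

(* The phantom parameter R is the type of the values of the metric. *)
Definition full_shift (R : realType) (K : nat) : Type := nat -> 'I_K.

Section FullShift.
Context {R : realType} {K : nat}.
Implicit Types x y z : full_shift R K.

HB.instance Definition _ := gen_eqMixin (full_shift R K).
HB.instance Definition _ := gen_choiceMixin (full_shift R K).

Definition shift_dist x y : R :=
  if pselect (exists i, x i != y i) is left ex
  then K%:R ^- ex_minn ex else 0.

Let shift_distxx x : shift_dist x x = 0.
Proof.
by rewrite /shift_dist; case: pselect => // ex; exfalso; case: ex => i; rewrite eqxx.
Qed.

Let K_gt0 x : 0 < K%:R :> R.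
Proof. by rewrite ltr0n (leq_ltn_trans _ (ltn_ord (x 0%N))). Qed.

Let shift_dist_ge0 x y : 0 <= shift_dist x y.
Proof.
by rewrite /shift_dist; case: pselect => // ex; rewrite invr_ge0 exprn_ge0.
Qed.

Let shift_dist_eq0 x y : shift_dist x y = 0 -> x = y.
Proof.
rewrite /shift_dist; case: pselect => [ex /eqP|nex _].
  by rewrite invr_eq0 expf_eq0 (gt_eqF (K_gt0 x)) andbF.
apply/funext => i; apply: contrapT => /eqP xy; apply: nex.
by exists i.
Qed.

Let shift_dist_sym x y : shift_dist x y = shift_dist y x.
Proof.
rewrite /shift_dist; case: pselect => [ex|nex]; case: pselect => [ex'|nex'] //.
- congr (_ ^- _); apply/eqP; rewrite eqn_leq.
  case: ex_minnP => m xym minm; case: ex_minnP => n yxn minn.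
  by rewrite minm ?minn// 1?eq_sym.
- by exfalso; apply: nex'; case: ex => i; rewrite eq_sym; exists i.
- by exfalso; apply: nex; case: ex' => i; rewrite eq_sym; exists i.
Qed.

Let shift_dist_ge x y i : x i != y i -> K%:R ^- i <= shift_dist x y.
Proof.
move=> xyi; rewrite /shift_dist; case: pselect => [ex|[]]; last by exists i.
case: ex_minnP => m _ /(_ _ xyi) mi.
have K1 : 1 <= K%:R :> R by rewrite ler1n -(ltr0n R) (K_gt0 x).
by rewrite lef_pV2 ?posrE ?exprn_gt0 ?(K_gt0 x)// ler_weXn2l.
Qed.

Let shift_dist_triangle y x z :
  shift_dist x z <= shift_dist x y + shift_dist y z.
Proof.
rewrite {1}/shift_dist; case: pselect => [ex|_]; last first.
  by rewrite addr_ge0.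
case: ex_minnP => m xzm _.
have [xym|xym] := eqVneq (x m) (y m).
  by rewrite -[leLHS]add0r lerD// shift_dist_ge// -xym.
by rewrite -[leLHS]addr0 lerD// shift_dist_ge.
Qed.

HB.instance Definition _ := isMetric.Build R (full_shift R K)
  shift_distxx shift_dist_eq0 shift_dist_sym shift_dist_triangle.

End FullShift.

Definition shift_map (R : realType) (K : nat) (x : full_shift R K) :
  full_shift R K := fun i => x i.+1.

Section DistributionalPairs.
Context {R : realType} {T : metricType R}.
Variable f : T -> T.

Definition prox_freq (x y : T) (e : R) (n : nat) : R :=
  #|[pred i : 'I_n | mdist (iter i f x) (iter i f y) < e]|%:R / n%:R.

Definition lower_dist (x y : T) (e : R) : R := limn_inf (prox_freq x y e).

Definition upper_dist (x y : T) (e : R) : R := limn_sup (prox_freq x y e).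

Definition E_set (p q : R) : set (T * T) :=
  [set z | (upper_dist z.1 z.2 e @[e --> 0^'+] --> q) /\
           (lower_dist z.1 z.2 e @[e --> 0^'+] --> p)].

Definition D_set (p q : R) : set (T * T) :=
  [set z | exists2 e0 : R, 0 < e0 & forall e, 0 < e <= e0 ->
    upper_dist z.1 z.2 e = q /\ lower_dist z.1 z.2 e = p].

End DistributionalPairs.

Section HausdorffMeasure.
Context {R : realType} {T : metricType R}.
Local Open Scope ereal_scope.

(* 0 is adjoined so that the empty set has diameter 0. *)
Definition diam (A : set T) : \bar R :=
  ereal_sup (0 |` [set (mdist z.1 z.2)%:E | z in A `*` A]).

(* The empty set contributes 0 also when s = 0, so that finite covers are
   covered by sequences padded with empty sets for every s. *)
Definition diam_pow (s : R) (A : set T) : \bar R :=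
  if A == set0 then 0 else poweR (diam A) s.

Definition hausdorff_pre (s delta : R) (A : set T) : \bar R :=
  ereal_inf [set \sum_(0 <= i <oo) diam_pow s (C i) | C in
    [set C : nat -> set T | A `<=` \bigcup_i C i /\
                            ereal_sup (range (diam \o C)) < delta%:E]].

Definition hausdorff_measure (s : R) (A : set T) : \bar R :=
  lim (hausdorff_pre s delta A @[delta --> 0^'+]).

End HausdorffMeasure.

(* Main.v *)
(* Call a window of length L at i agreeing when x and y coincide on [i, i + L); the
   distribution functions at scale K^-(L-1) are the frequencies of such windows.
   Hausdorff measures are compared with masses on the tree of finite words: a
   nonnegative function V of words whose sum over the children of a word is at most
   its value there. If V is much larger than diam^s infinitely often along every
   point of a set, the set is H^s-null; if a mass W is at most diam^s / G on all
   long words, then any set that carries W has H^s-measure at least G, and one may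
   discard the points along which countably many other masses V_j are not O(W).

   D for q < 1: there L-windows and (L+1)-windows have the same upper frequency q for
   some L, so at suitable times the pair is a concatenation of few long agreements,
   covering about q n positions, and of stretches without agreement of length L,
   whose entropy is strictly smaller than that of free pairs. A Markov mass following
   the current run length turns this into nullity for dimension 2 - q.

   E, and D for q = 1: x is free, and y copies x on a union of blocks [k^2, (k+1)^2)
   chosen greedily so that their lower and upper densities are p and q, but so slowly
   that at time n the agreement is below q n by a diverging amount; this makes the
   measure infinite when q > 0. Off these blocks y is free (if q < 1), and a betting
   argument shows that free positions contribute agreeing L-windows with frequency
   O(1 / L) only. *)

Require Import Defs.
From mathcomp Require Import all_boot all_order all_algebra.
From mathcomp Require Import all_classical all_reals all_analysis.
From mathcomp Require Import ring lra.

Set Implicit Arguments.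
Unset Strict Implicit.
Unset Printing Implicit Defensive.

Import Order.TTheory GRing.Theory Num.Theory.
Import numFieldNormedType.Exports.

Local Open Scope classical_set_scope.
Local Open Scope ring_scope.

(** * Words and masses on the tree of words *)

Section Words.
Context {R : realType} {A : finType}.
Implicit Types (s t u : seq A) (z : nat -> A).

(* Words are stored most recent letter first: [pre z n] is z_(n-1) ... z_0. *)
Fixpoint pre z n : seq A := if n is m.+1 then z m :: pre z m else [::].

Lemma size_pre z n : size (pre z n) = n.
Proof. by elim: n => //= n ->. Qed.

Lemma pre_eqP z w n : pre z n = pre w n <-> forall i, (i < n)%N -> z i = w i.
Proof.
elim: n => [|n IH] /=; first by split.
split=> [[zw /IH H] i|H].
  by rewrite ltnS leq_eqVlt => /orP[/eqP->|/H].
by rewrite H//; congr cons; apply/IH => i ni; apply: H; apply: ltnW.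
Qed.

Lemma suffix_consE s t a : suffix s (a :: t) = (s == a :: t) || suffix s t.
Proof.
apply/suffixP/orP => [[[|b r] /=]|[/eqP->|/suffixP[r ->]]].
- by move=> ->; left.
- by case=> _ ->; right; apply/suffixP; exists r.
- by exists [::].
- by exists (a :: r).
Qed.

Lemma suffix_preP z n s : suffix s (pre z n) -> exists2 m, (m <= n)%N & s = pre z m.
Proof.
elim: n => [|n IH] /=; first by rewrite suffixs0 => /eqP ->; exists 0%N.
rewrite suffix_consE => /orP[/eqP->|/IH[m mn ->]]; first by exists n.+1.
by exists m => //; apply: leq_trans mn _.
Qed.

Lemma suffix_cons_step s t : suffix s t -> s != t -> exists a, suffix (a :: s) t.
Proof.
move=> /suffixP[r ->]; elim/last_ind: r => [|r a _]; first by rewrite eqxx.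
by exists a; rewrite cat_rcons; exact: suffix_suffix.
Qed.

Lemma suffix_cons_inj s t a b : suffix (a :: s) t -> suffix (b :: s) t -> a = b.
Proof.
move=> /suffixP[r ->] /suffixP[r' /eqP]; rewrite -!cat_rcons.
have E : size (rcons r a) = size (rcons r' b) -> rcons r a ++ s = rcons r' b ++ s -> a = b.
  by move=> sz /eqP; rewrite eqseq_cat// => /andP[/eqP/rcons_inj[]].
move=> /eqP H; apply: E => //; move/(congr1 size): H; rewrite !size_cat.
by move=> /addIn.
Qed.

Section Ereal.
Local Open Scope ereal_scope.

(** Mass may be lost from a word to its children, which admits potentials and killed chains; values
    are extended so that countable sums stay in the class. *)
Definition submass (V : seq A -> \bar R) :=
  (forall s, 0 <= V s) /\ (forall s, \sum_a V (a :: s) <= V s).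

(** Induction on the depth left below [s]: either [s] is the only element of [l], or every element
    lies below exactly one child of [s], and the children share [V s]. *)
Lemma antichain_sum V (l : seq (seq A)) s : submass V -> uniq l ->
  {in l, forall t, suffix s t} -> {in l &, forall t u, suffix t u -> t = u} ->
  \sum_(t <- l) V t <= V s.
Proof.
move=> [V0 Vs].
pose n := \max_(t <- l) size t.
have ln t : t \in l -> (size t <= n)%N by move=> tl; exact: (leq_bigmax_seq _ tl).
move: n ln => n ln.
have [k] := ubnP (n - size s); elim: k s l ln => // k IH s l ln nk ul sl al.
have [sinl|snl] := boolP (s \in l).
  suff -> : l = [:: s] by rewrite big_seq1.
  have all_s : {in l, forall t, t = s} by move=> t tl; rewrite -(al s t)// sl.
  case: l ul sinl all_s {ln sl al} => // t l /= /andP[tl _] _ H.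
  case: l tl H => [|u l] tl H; first by rewrite (H t)// mem_head.
  by move: tl; rewrite (H t) ?mem_head// (H u) ?mem_head// !inE ?eqxx ?orbT.
have step t : t \in l -> exists a, suffix (a :: s) t.
  move=> tl; apply: suffix_cons_step; first exact: sl.
  by apply: contraNN snl => /eqP ->.
apply: le_trans (Vs s).
have -> : \sum_(t <- l) V t = \sum_a \sum_(t <- [seq t <- l | suffix (a :: s) t]) V t.
  under [RHS]eq_bigr do rewrite big_filter big_mkcond /=.
  rewrite exchange_big /= !big_seq; apply: eq_bigr => t tl.
  have [a at_] := step t tl.
  rewrite (bigD1 a)//= at_ big1 ?adde0// => b /negbTE ba.
  by case: ifP => // bt; move: ba; rewrite (suffix_cons_inj at_ bt) eqxx.
apply: lee_sum => a _.
have [->|hne] := eqVneq [seq t <- l | suffix (a :: s) t] [::].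
  by rewrite big_nil.
have [t tf] : exists t, t \in [seq t <- l | suffix (a :: s) t].
  by case: [seq _ <- _ | _] hne => // t ? _; exists t; exact: mem_head.
have sn : (size s < n)%N.
  move: tf; rewrite mem_filter => /andP[/size_suffix ? /ln]; exact: leq_trans.
apply: IH.
- by move=> u; rewrite mem_filter => /andP[_ /ln].
- by rewrite /=; move: nk; rewrite !ltnS => nk; apply: leq_trans nk; rewrite ltn_sub2l.
- exact: filter_uniq.
- by move=> u; rewrite mem_filter => /andP[].
- by move=> u v; rewrite !mem_filter => /andP[_ ul'] /andP[_ vl]; exact: al.
Qed.

(** If every child lost the strict inequality, summing over the children would contradict it at the
    parent; following good children forever yields [z]. *)
Lemma tree_walk (W : seq A -> R) (m : seq A -> \bar R) :
  (forall s, (W s <= \sum_a W (a :: s))%R) ->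
  (forall s, \sum_a m (a :: s) <= m s) ->
  m [::] < (W [::])%:E -> exists z, forall n, m (pre z n) < (W (pre z n))%:E.
Proof.
move=> Ws ms m0.
have step s : m s < (W s)%:E -> exists a, m (a :: s) < (W (a :: s))%:E.
  move=> msW; apply: contrapT => /forallNP H.
  have : (W s)%:E <= m s.
    apply: le_trans (ms s); apply: (@le_trans _ _ (\sum_a (W (a :: s))%:E)).
      by rewrite sumEFin lee_fin.
    by apply: lee_sum => a _; rewrite leNgt; apply/negP/H.
  by rewrite leNgt msW.
(* A default letter for the words at which the inequality fails. *)
have [a0 _] := step _ m0.
have /choice[f fP] : forall s, exists a, m s < (W s)%:E -> m (a :: s) < (W (a :: s))%:E.
  move=> s; have [/step[a aP]|] := boolP (m s < (W s)%:E); first by exists a.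
  by exists a0.
pose t := fix t n := if n is n'.+1 then f (t n') :: t n' else [::].
exists (fun n => f (t n)) => n.
have -> : pre (fun n => f (t n)) n = t n by elim: n => //= n ->.
by elim: n => //= n; exact: fP.
Qed.

End Ereal.
End Words.

(** * Hausdorff measure of sets of pairs *)

Section Shift.
Context {R : realType} {K : nat}.
Hypothesis hK : (2 <= K)%N.
Local Notation T := (full_shift R K).
Local Notation A := ('I_K * 'I_K)%type.

Definition pairs (z : T * T) : nat -> A := fun i => (z.1 i, z.2 i).

Lemma K_gt0 : 0 < K%:R :> R.
Proof. by rewrite ltr0n (leq_trans _ hK). Qed.

Lemma K_gt1 : 1 < K%:R :> R.
Proof. by rewrite ltr1n. Qed.

(** The strict bound forces agreement at [n] itself, which is why the scale [K^-n] goes with windows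
    of length [n.+1] later. *)
Lemma mdist_shift_lt (x y : T) n :
  mdist x y < K%:R ^- n :> R <-> forall i, (i <= n)%N -> x i = y i.
Proof.
rewrite [mdist x y]/(shift_dist x y) /shift_dist.
case: pselect => [ex|nex]; last first.
  split=> [_ i _|_]; last by rewrite invr_gt0 exprn_gt0// K_gt0.
  by apply: contrapT => /eqP xy; apply: nex; exists i.
case: ex_minnP => m xym minm.
rewrite ltf_pV2 ?posrE ?exprn_gt0 ?K_gt0// ltr_eXn2l ?K_gt1//.
split=> [nm i ni|H].
  apply/eqP/negPn/negP => /minm mi.
  by have := leq_trans (leq_ltn_trans ni nm) mi; rewrite ltnn.
by rewrite ltnNge; apply: contraNN xym => /H ->.
Qed.

Lemma mdist_shift_le (x y : T) n :
  (forall i, (i < n)%N -> x i = y i) -> mdist x y <= K%:R ^- n :> R.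
Proof.
move=> xy; rewrite [mdist x y]/(shift_dist x y) /shift_dist.
case: pselect => [ex|_]; last by rewrite invr_ge0 exprn_ge0// ltW// K_gt0.
case: ex_minnP => m xym _.
rewrite lef_pV2 ?posrE ?exprn_gt0 ?K_gt0// ler_eXn2l ?K_gt1// leqNgt.
by apply: contraNN xym => /xy ->.
Qed.

Lemma mdist_pairE (z w : T * T) : mdist z w = Num.max (mdist z.1 w.1) (mdist z.2 w.2) :> R.
Proof. by []. Qed.

Lemma mdist_pair_le (z w : T * T) n :
  pre (pairs z) n = pre (pairs w) n -> mdist z w <= K%:R ^- n :> R.
Proof.
move=> /pre_eqP zw; rewrite mdist_pairE ge_max; apply/andP; split.
  by apply: mdist_shift_le => i /zw [].
by apply: mdist_shift_le => i /zw [].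
Qed.

Lemma mdist_pair_ge (z w : T * T) n :
  pre (pairs z) n.+1 <> pre (pairs w) n.+1 -> K%:R ^- n <= mdist z w :> R.
Proof.
move=> zw; rewrite mdist_pairE le_max leNgt [X in _ || X]leNgt -negb_and; apply/negP.
move=> /andP[/mdist_shift_lt z1 /mdist_shift_lt z2]; apply/zw/pre_eqP => i.
by rewrite ltnS /pairs => ni; rewrite z1// z2.
Qed.

Lemma expr_inv_small (d : R) : 0 < d -> exists n, K%:R ^- n < d.
Proof.
move=> d0; have [n _ /(_ n (leqnn _))] : \forall n \near \oo, K%:R ^- n < d.
  have /cvgrPdist_lt/(_ d d0) : (K%:R^-1 : R) ^+ n @[n --> \oo] --> (0 : R).
    by apply: cvg_expr; rewrite ger0_norm ?invr_ge0 ?ler0n// invf_lt1 ?K_gt1// K_gt0.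
  apply: filterS => n; rewrite sub0r normrN exprVn ger0_norm ?invr_ge0 ?exprn_ge0// ltW// K_gt0.
by exists n.
Qed.

End Shift.

Section HausdorffGeneral.
Context {R : realType} {T : metricType R}.
Local Open Scope ereal_scope.
Implicit Types (s : R) (X : set T).

Lemma diam_ge0 X : 0 <= diam X.
Proof. by apply: ereal_sup_ubound; left. Qed.

Lemma diam_le X (r : R) : (0 <= r)%R ->
  (forall x y, X x -> X y -> (mdist x y <= r)%R) -> diam X <= r%:E.
Proof.
move=> r0 H; apply: ge_ereal_sup => _ [->|[[x y] [/= Xx Xy] <-]]; rewrite lee_fin//.
exact: H.
Qed.

Lemma le_diam X x y : X x -> X y -> (mdist x y)%:E <= diam X.
Proof. by move=> Xx Xy; apply: ereal_sup_ubound; right; exists (x, y). Qed.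

Lemma diam_pow_ge0 s X : 0 <= diam_pow s X.
Proof. by rewrite /diam_pow; case: ifP => // _; exact: poweR_ge0. Qed.

Lemma diam_pow_le s X (r : R) : (0 <= s)%R -> (0 <= r)%R ->
  diam X <= r%:E -> diam_pow s X <= (r `^ s)%:E.
Proof.
move=> s0 r0 Xr; rewrite /diam_pow; case: ifP => _; first by rewrite lee_fin powR_ge0.
rewrite -poweR_EFin; apply: gt0_ler_poweR => //;
  by rewrite in_itv/= ?diam_ge0 ?lee_fin ?r0 ?leey.
Qed.

Lemma diam_pow_ge s X (r : R) : (0 <= s)%R -> (0 <= r)%R -> X !=set0 ->
  r%:E <= diam X -> (r `^ s)%:E <= diam_pow s X.
Proof.
move=> s0 r0 /set0P/negbTE X0 Xr; rewrite /diam_pow X0.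
rewrite -poweR_EFin; apply: gt0_ler_poweR => //;
  by rewrite in_itv/= ?diam_ge0 ?lee_fin ?r0 ?leey.
Qed.

Lemma hausdorff_pre_ge0 s d X : 0 <= hausdorff_pre s d X.
Proof.
apply: le_ereal_inf_tmp => _ [C _ <-]; apply: nneseries_ge0 => *.
exact: diam_pow_ge0.
Qed.

Lemma hausdorff_pre_noninc s X :
  {homo (fun d => hausdorff_pre s d X) : d d' / (d <= d')%R >-> d' <= d}.
Proof.
move=> d d' dd'; apply: ereal_inf_le_tmp => _ [C [XC Cd] <-]; exists C => //; split => //.
by apply: lt_le_trans Cd _; rewrite lee_fin.
Qed.

Lemma is_cvg_hausdorff_pre s X : cvg (hausdorff_pre s d X @[d --> (0:R)^'+]).
Proof.
apply: nonincreasing_at_right_is_cvge; near=> e => x y _ _.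
exact: hausdorff_pre_noninc.
Unshelve. all: by end_near. Qed.

Lemma hausdorff_measure_le s X c :
  (forall d : R, (0 < d)%R -> hausdorff_pre s d X <= c) -> hausdorff_measure s X <= c.
Proof.
move=> H; apply: lime_le; first exact: is_cvg_hausdorff_pre.
by near=> d; apply: H; near: d; exact: nbhs_right_gt.
Unshelve. all: by end_near. Qed.

Lemma hausdorff_measure_ge s X c (d0 : R) : (0 < d0)%R ->
  (forall d : R, (0 < d < d0)%R -> c <= hausdorff_pre s d X) -> c <= hausdorff_measure s X.
Proof.
move=> d00 H; apply: lime_ge; first exact: is_cvg_hausdorff_pre.
near=> d; apply: H; apply/andP; split; near: d; first exact: nbhs_right_gt.
exact: nbhs_right_lt.
Unshelve. all: by end_near. Qed.

Lemma hausdorff_measure_ge0 s X : 0 <= hausdorff_measure s X.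
Proof. by apply: (@hausdorff_measure_ge _ _ _ 1%R) => // d _; exact: hausdorff_pre_ge0. Qed.

End HausdorffGeneral.

Section SubmassTheory.
Context {R : realType} {A : finType}.
Local Open Scope ereal_scope.
Implicit Types (V : seq A -> \bar R).

Lemma submass_series (V : nat -> seq A -> \bar R) : (forall j, submass (V j)) ->
  submass (fun s => \sum_(0 <= j <oo) V j s).
Proof.
move=> HV; split=> s; first by apply: nneseries_ge0 => j _ _; exact: (HV j).1.
rewrite -nneseries_sum; last by move=> a j _; exact: (HV j).1.
apply: lee_nneseries => j; last by move=> _; exact: (HV j).2.
by move=> _ _; apply: sume_ge0 => a _; exact: (HV j).1.
Qed.

Lemma submassZ V (c : R) : (0 <= c)%R -> submass V -> submass (fun s => c%:E * V s).
Proof.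
move=> c0 [V0 VS]; split=> s; first by rewrite mule_ge0.
rewrite -ge0_sume_distrr; last by move=> a _; exact: V0.
by rewrite lee_wpmul2l.
Qed.

Lemma submassD V V' : submass V -> submass V' -> submass (fun s => V s + V' s).
Proof.
move=> [V0 VS] [V0' VS']; split=> s; first by rewrite adde_ge0.
by rewrite big_split/= leeD.
Qed.

Lemma submass_EFin (V : seq A -> R) : (forall s, (0 <= V s)%R) ->
  (forall s, (\sum_a V (a :: s) <= V s)%R) -> submass (EFin \o V).
Proof.
by move=> V0 VS; split=> s /=; rewrite ?lee_fin// sumEFin lee_fin.
Qed.

End SubmassTheory.

(** * Upper bounds: covers by cylinders of large submass *)

Section Upper.
Context {R : realType} {K : nat}.
Hypothesis hK : (2 <= K)%N.
Local Notation T := (full_shift R K).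
Local Notation A := ('I_K * 'I_K)%type.
Local Open Scope ereal_scope.

Definition cylinder (t : seq A) : set (T * T) :=
  [set z | pre (pairs z) (size t) = t].

Lemma diam_cylinder t : diam (cylinder t) <= (K%:R ^- size t)%:E.
Proof.
apply: diam_le; first by rewrite invr_ge0 exprn_ge0// ltW// K_gt0.
by move=> x y cx cy; apply: mdist_pair_le => //; rewrite cx cy.
Qed.

(* The words in the cover are the shortest prefixes, of length at least [n0], at
   which [V] is large: they form an antichain. *)
Lemma hausdorff_measure_le_submass (s M : R) (V : seq A -> \bar R) (X : set (T * T)) :
  (0 <= s)%R -> (0 < M)%R -> submass V -> V [::] <= 1 ->
  (forall z, X z -> forall n0, exists2 n, (n0 <= n)%N &
     (M * (K%:R ^- n) `^ s)%:E <= V (pre (pairs z) n)) ->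
  hausdorff_measure s X <= (M^-1)%:E.
Proof.
move=> s0 M0 HV V1 HX; apply: hausdorff_measure_le => d d0.
have [n0 n0d] := expr_inv_small hK d0.
pose good t := (n0 <= size t)%N /\ (M * (K%:R ^- size t) `^ s)%:E <= V t.
pose J t := `[< good t /\ forall u, suffix u t -> good u -> u = t >].
(* The cover is indexed by the codes of words; the other indices give the empty set, which adds
   nothing to the sum. *)
pose C i := if pickle_inv i is Some t then if J t then cylinder t else set0 else set0.
pose w i := diam_pow s (C i).
have dpow t : J t -> diam_pow s (cylinder t) <= (M^-1)%:E * V t.
  move=> /asboolP[[_ tV] _].
  apply: le_trans (diam_pow_le s0 _ (diam_cylinder t)) _.
    by rewrite invr_ge0 exprn_ge0// ltW// K_gt0.
  rewrite lee_pdivlMl//; apply: le_trans tV; rewrite EFinM lexx//.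
apply: (@le_trans _ _ (\sum_(0 <= i <oo) w i)).
  apply: ereal_inf_lbound; exists C => //; split=> [z Xz|].
    have ex : exists n, `[< good (pre (pairs z) n) >].
      have [n nn0 nV] := HX z Xz n0; exists n; apply/asboolP; split; by rewrite size_pre.
    case: (ex_minnP ex) => n /asboolP gn minn.
    exists (pickle (pre (pairs z) n)) => //; rewrite /C pickleK_inv.
    suff -> : J (pre (pairs z) n) by rewrite /cylinder /= size_pre.
    apply/asboolP; split=> // u /suffix_preP[m mn ->] gm.
    suff -> : m = n by [].
    by apply/eqP; rewrite eqn_leq mn; apply: minn; apply/asboolP.
  apply: le_lt_trans (_ : (K%:R ^- n0)%:E < _); last by rewrite lte_fin.
  have K0 n : (0 <= K%:R ^- n :> R)%R by rewrite invr_ge0 exprn_ge0// ltW// K_gt0.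
  apply: ge_ereal_sup => _ [i _ <-] /=; rewrite /C.
  case: (pickle_inv i) => [t|]; last by apply: diam_le.
  case: ifPn => [/asboolP[[nt _] _]|_]; last by apply: diam_le.
  apply: le_trans (diam_cylinder t) _; rewrite lee_fin.
  by rewrite lef_pV2 ?posrE ?exprn_gt0 ?K_gt0// ler_weXn2l// ltW// K_gt1.
apply: lime_le; first by apply: is_cvg_nneseries => *; exact: diam_pow_ge0.
near=> N; pose l := [seq t <- pmap pickle_inv (index_iota 0 N) | J t].
have -> : \sum_(0 <= i < N) w i = \sum_(t <- l) diam_pow s (cylinder t).
  rewrite [RHS]big_filter [RHS]big_mkcond/= [RHS]big_pmap/=.
  apply: eq_bigr => i _; rewrite /w /C; case: (pickle_inv i) => [t|]/=.
    by case: ifP => //; rewrite /diam_pow eqxx.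
  by rewrite /diam_pow eqxx.
apply: (@le_trans _ _ (\sum_(t <- l) (M^-1)%:E * V t)).
  rewrite big_filter big_filter; apply: lee_sum => t Jt; exact: dpow.
rewrite -ge0_sume_distrr; last by move=> t _; exact: HV.1.
rewrite -[leRHS]mule1 lee_pmul2l ?lte_fin ?invr_gt0//; apply: le_trans V1.
apply: antichain_sum => //.
- by apply/filter_uniq/(pmap_uniq (@pickle_invK _)); exact: iota_uniq.
- by move=> t _; exact: suffix0s.
move=> t u; rewrite !mem_filter => /andP[/asboolP[gt _] _] /andP[/asboolP[_ Hu] _] tu.
exact: Hu.
Unshelve. all: by end_near. Qed.

(** Mixing the [V j] with weights [2^-(j+1)] gives a single submass. Since [V j] exceeds every
    multiple of [diam^s], its weight is absorbed in the constant [M]. *)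
Lemma hausdorff_measure_eq0 (s : R) (V : nat -> seq A -> R) (X : set (T * T)) :
  (0 <= s)%R -> (forall j, submass (EFin \o V j)) -> (forall j, (V j [::] <= 1)%R) ->
  (forall z, X z -> exists j, forall M n0, exists2 n, (n0 <= n)%N &
     (M * (K%:R ^- n) `^ s <= V j (pre (pairs z) n))%R) ->
  hausdorff_measure s X = 0.
Proof.
move=> s0 HV V1 HX; apply/eqP; rewrite eq_le hausdorff_measure_ge0 andbT.
apply/lee_addgt0Pr => e e0; rewrite add0e -[e]invrK.
pose c j : R := ((1 : R) / (2 ^ j.+1)%:R)%R.
have c0 j : (0 < c j)%R by rewrite divr_gt0// ltr0n expn_gt0.
have V0 i u : 0 <= (c i)%:E * (V i u)%:E.
  by rewrite mule_ge0 ?lee_fin ?(ltW (c0 _))//; have := (HV i).1 u; rewrite lee_fin.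
apply: (@hausdorff_measure_le_submass _ _
  (fun u => \sum_(0 <= j <oo) ((c j)%:E * (V j u)%:E))) => //.
- by rewrite invr_gt0.
- by apply: submass_series => j; exact: (submassZ (ltW (c0 j)) (HV j)).
- apply: le_trans (epsilon_trick0 xpredT ler01); apply: lee_nneseries.
    by move=> j _ _; exact: V0.
  by move=> j _; rewrite -EFinM lee_fin ler_piMr//; exact: ltW.
move=> z /HX[j Hj] n0; have [n nn0 Hn] := Hj (e^-1 / c j)%R n0; exists n => //.
apply: le_trans (nneseries_lim_ge j.+1 _); last by move=> i _ _; exact: V0.
rewrite big_nat_recr//= -[leLHS]add0e leeD//; first exact: sume_ge0.
by rewrite -EFinM lee_fin -ler_pdivrMl// mulrA [((c j)^-1 * _)%R]mulrC.
Qed.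

End Upper.

(** * Lower bounds: a mass that a cheap cover cannot exhaust *)

Section Lower.
Context {R : realType} {K : nat}.
Hypothesis hK : (2 <= K)%N.
Local Notation T := (full_shift R K).
Local Notation A := ('I_K * 'I_K)%type.
Variable W : seq A -> R.
Hypothesis W_ge0 : forall t, 0 <= W t.
Hypothesis W_sum : forall t, \sum_a W (a :: t) = W t.

(** The [W]-mass of the intersection of the cylinders of [t] and [u]. *)
Definition mass_in (t u : seq A) : R :=
  if suffix u t then W t else if suffix t u then W u else 0.

Lemma mass_in_ge0 t u : 0 <= mass_in t u.
Proof. by rewrite /mass_in; case: ifP => // _; case: ifP. Qed.

Lemma mass_in_submass t : submass (EFin \o mass_in t).
Proof.
apply: submass_EFin => u; first exact: mass_in_ge0.
have [tu|tu] := boolP (suffix t u).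
  have -> : mass_in t u = W u.
    rewrite /mass_in tu; case: ifP => // ut.
    suff -> : t = u by [].
    move: tu ut => /suffixP[r ->] /size_suffix; rewrite size_cat.
    by case: r => //= a r; rewrite addSn ltnNge leq_addl.
  rewrite -(W_sum u); apply: ler_sum => a _; rewrite /mass_in.
  rewrite ifF; first by rewrite suffix_consE tu orbT.
  by apply/negP => /size_suffix ut; move/size_suffix: tu => /(leq_trans ut); rewrite ltnn.
have [ut|ut] := boolP (suffix u t); last first.
  rewrite /mass_in (negbTE tu) (negbTE ut) big1// => a _.
  have aut : ~~ suffix (a :: u) t.
    by apply: contra ut; apply: suffix_trans; exact: suffix_cons.
  rewrite (negbTE aut) suffix_consE (negbTE tu) orbF; case: eqP => // E.
  by move: aut; rewrite E suffix_refl.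
have [|a aP] := suffix_cons_step ut; first by apply: contraNN tu => /eqP ->; exact: suffix_refl.
have -> : mass_in t u = W t by rewrite /mass_in ut.
have taP : mass_in t (a :: u) = W t by rewrite /mass_in aP.
rewrite (bigD1 a)//= taP big1 ?addr0// => b /negbTE ba.
have but : ~~ suffix (b :: u) t.
  by apply/negP => bu; move: ba; rewrite (suffix_cons_inj bu aP) eqxx.
rewrite /mass_in (negbTE but) suffix_consE (negbTE tu) orbF; case: eqP => // E.
by move: but; rewrite E suffix_refl.
Qed.

Lemma mass_in_nil t : mass_in t [::] = W t.
Proof. by rewrite /mass_in suffix0s. Qed.

Lemma mass_in_id t : mass_in t t = W t.
Proof. by rewrite /mass_in suffix_refl. Qed.

(** Given a cover of cost below [G], add the masses of [W] in cylinders around its members to small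
    multiples of the [V j]. The root value is below [W [::] = 1], so [tree_walk] finds a point where
    the total stays below [W]: there each [V j] is [O(W)], so the point is in [X], yet it avoids
    every member of the cover. *)
Lemma hausdorff_measure_ge_mass (s G : R) (V : nat -> seq A -> R) (X : set (T * T)) (n0 : nat) :
  0 < s -> 0 < G -> W [::] = 1 ->
  (forall j, submass (EFin \o V j)) -> (forall j, V j [::] <= 1) ->
  (forall t, (n0 <= size t)%N -> G * W t <= (K%:R ^- size t) `^ s) ->
  (forall z, (forall n, 0 < W (pre (pairs z) n)) ->
     (forall j, exists C, forall n, V j (pre (pairs z) n) <= C * W (pre (pairs z) n)) -> X z) ->
  (G%:E <= hausdorff_measure s X)%E.
Proof.
move=> s0 G0 W1 HV V1 WG HX.
have Kp n : 0 < K%:R ^- n :> R by rewrite invr_gt0 exprn_gt0// K_gt0.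
apply: (@hausdorff_measure_ge _ _ _ _ _ (K%:R ^- n0)) => // d /andP[d0 dn0].
apply: le_ereal_inf_tmp => _ [C [XC Cd] <-]; rewrite leNgt; apply/negP => SG.
set S := (\sum_(0 <= i <oo) _)%E in SG.
have S0 : (0 <= S)%E by apply: nneseries_ge0 => *; exact: diam_pow_ge0.
have Sfin : S \is a fin_num by rewrite ge0_fin_numE// (lt_trans SG)// ltry.
have {SG} SG : fine S < G by rewrite -lte_fin fineK.
(* The slack is cut in three: one part for the one-point members of the cover, one for the [V j],
   one to keep the inequality strict. *)
pose e := (1 - fine S / G) / 3.
have e0 : 0 < e by rewrite divr_gt0// subr_gt0 ltr_pdivrMr// mul1r.
pose c j : R := e / (2 ^ j.+1)%:R.
have c0 j : 0 < c j by rewrite divr_gt0// ltr0n expn_gt0.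
(* [W] tends to 0 uniformly with the length of the word, so a member of diameter 0 fits in a
   cylinder of negligible mass. *)
have small : forall eps : R, 0 < eps -> exists n, forall t, size t = n -> W t <= eps.
  move=> eps eps0.
  have [n nlt] := expr_inv_small hK (powR_gt0 s^-1 (mulr_gt0 G0 eps0)).
  exists (maxn n n0) => t st; rewrite -(ler_pM2l G0).
  apply: le_trans (WG t _) _; first by rewrite st leq_maxr.
  have -> : G * eps = ((G * eps) `^ s^-1) `^ s.
    by rewrite -powRrM mulVf ?gt_eqF// powRr1// mulr_ge0// ltW.
  apply: (ge0_ler_powR (ltW s0)); rewrite ?nnegrE ?powR_ge0 ?(ltW (Kp _))//.
  apply: ltW; apply: le_lt_trans nlt; rewrite lef_pV2 ?posrE ?exprn_gt0 ?K_gt0//.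
  rewrite ler_weXn2l ?st ?leq_maxl//.
  by rewrite ltW// K_gt1.
have cover i : exists m : seq A -> R, [/\ submass (EFin \o m),
    ((m [::])%:E <= (G^-1)%:E * diam_pow s (C i) + (c i)%:E)%E &
    forall z, C i z -> exists n, W (pre (pairs z) n) <= m (pre (pairs z) n)].
  have dp0 : (0 <= (G^-1)%:E * diam_pow s (C i))%E.
    by rewrite mule_ge0 ?diam_pow_ge0// lee_fin invr_ge0 ltW.
  have [Ci0|/set0P[x Cx]] := eqVneq (C i) set0.
    exists (fun=> 0); split; last by rewrite Ci0.
      by apply: submass_EFin => // u; rewrite big1.
    by rewrite adde_ge0 ?lee_fin ?(ltW (c0 i)).
  have [same|] := pselect (forall n z, C i z -> pre (pairs z) n = pre (pairs x) n).
    have [n Wn] := small _ (c0 i).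
    exists (mass_in (pre (pairs x) n)); split.
    - exact: mass_in_submass.
    - by rewrite mass_in_nil -[leLHS]add0e leeD// lee_fin Wn// size_pre.
    - by move=> z Cz; exists n; rewrite (same n z Cz) mass_in_id.
  move=> /existsNP[n' /existsNP[y' /not_implyP[Cy' xy']]].
  have ex : exists n, `[< exists2 y, C i y & pre (pairs y) n <> pre (pairs x) n >].
    by exists n'; apply/asboolP; exists y'.
  (* Here [n] is the length of the longest prefix common to all points of [C i], so its cylinder
     contains [C i] and [diam (C i)] is at least [K^-n]. *)
  case: (ex_minnP ex) => -[|n] /asboolP[y Cy yx] minn; first by [].
  have dn : ((K%:R ^- n)%:E <= diam (C i))%E.
    by apply: le_trans (le_diam Cy Cx); rewrite lee_fin; exact: mdist_pair_ge.
  exists (mass_in (pre (pairs x) n)); split.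
  - exact: mass_in_submass.
  - rewrite mass_in_nil -[leLHS]adde0 leeD ?lee_fin ?(ltW (c0 i))//.
    rewrite lee_pdivlMl// -EFinM.
    apply: (@le_trans _ _ ((K%:R ^- n) `^ s)%:E); last first.
      by apply: (diam_pow_ge (ltW s0) (ltW (Kp n)) _ dn); exists x.
    rewrite lee_fin -{2}(size_pre (pairs x) n); apply: WG; rewrite size_pre.
    have : ((K%:R ^- n)%:E < (K%:R ^- n0 : R)%:E)%E.
      apply: (le_lt_trans dn); apply: (@lt_trans _ _ d%:E); last by rewrite lte_fin.
      by apply: le_lt_trans Cd; apply: ereal_sup_ubound; exists i.
    rewrite lte_fin ltf_pV2 ?posrE ?exprn_gt0 ?K_gt0// ltr_eXn2l ?K_gt1//.
    exact: ltnW.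
  - move=> z Cz; exists n; suff -> : pre (pairs z) n = pre (pairs x) n by rewrite mass_in_id.
    apply: contrapT => zx; suff : (n.+1 <= n)%N by rewrite ltnn.
    by apply: minn; apply/asboolP; exists z.
have [m mP] := choice cover.
pose M u := (\sum_(0 <= i <oo) (m i u)%:E + \sum_(0 <= j <oo) ((c j)%:E * (V j u)%:E))%E.
have m0 i u : (0 <= (m i u)%:E)%E by have [[+ _] _ _] := mP i; apply.
have V0 j u : (0 <= (c j)%:E * (V j u)%:E)%E.
  by rewrite mule_ge0 ?lee_fin ?(ltW (c0 _))//; have := (HV j).1 u; rewrite lee_fin.
have [M0 MS] : submass M.
  apply: submassD; apply: submass_series => j; first by have [] := mP j.
  exact: (submassZ (ltW (c0 j)) (HV j)).
have Mm i u : ((m i u)%:E <= M u)%E.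
  rewrite -[leLHS]adde0 leeD ?nneseries_ge0//.
  apply: le_trans (nneseries_lim_ge i.+1 _); last by move=> ? _ _; exact: m0.
  by rewrite big_nat_recr//= -[leLHS]add0e leeD//; exact: sume_ge0.
have MV j u : ((c j)%:E * (V j u)%:E <= M u)%E.
  rewrite -[leLHS]add0e leeD ?nneseries_ge0//.
  apply: le_trans (nneseries_lim_ge j.+1 _); last by move=> ? _ _; exact: V0.
  by rewrite big_nat_recr//= -[leLHS]add0e leeD//; exact: sume_ge0.
have Mnil : (M [::] < (W [::])%:E)%E.
  apply: (@le_lt_trans _ _ (((G^-1)%:E * S + e%:E) + e%:E)%E).
    apply: leeD; last first.
      apply: le_trans (epsilon_trick0 xpredT (ltW e0)); apply: lee_nneseries => //.
      by move=> j _; rewrite -EFinM lee_fin ler_piMr// ltW.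
    rewrite /S -nneseriesZl; last by move=> *; exact: diam_pow_ge0.
    apply: le_trans (epsilon_trick xpredT _ (ltW e0)); last first.
      by move=> i; rewrite mule_ge0 ?diam_pow_ge0// lee_fin invr_ge0 ltW.
    by apply: lee_nneseries => // i _; have [] := mP i.
  rewrite -(fineK Sfin) -EFinM -!EFinD lte_fin W1 mulrC.
  have : fine S / G + 3 * e = 1 by rewrite /e; lra.
  by have := e0; lra.
have [|zeta zP] := tree_walk _ MS Mnil; first by move=> u; rewrite W_sum.
pose z : T * T := (fun i => (zeta i).1, fun i => (zeta i).2).
have zE : pairs z = zeta by apply/funext => i; rewrite /pairs -surjective_pairing.
have Xz : X z.
  apply: HX => [n|j]; rewrite zE.
    by rewrite -lte_fin; apply: le_lt_trans (zP n).
  exists ((c j)^-1) => n; rewrite -ler_pdivrMl ?invr_gt0// invrK -lee_fin EFinM.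
  by apply: le_trans (MV j _) _; exact: ltW.
have [i _ Ciz] := XC _ Xz.
have [_ _ /(_ z Ciz)[n]] := mP i; rewrite zE => Wm.
have := le_lt_trans (Mm i (pre zeta n)) (zP n).
by rewrite lte_fin ltNge Wm.
Qed.

End Lower.

(** * Frequencies and windows of agreement *)

Section LimSupInf.
Context {R : realType}.
Implicit Types u : nat -> R.

Section UnitInterval.
Variable u : nat -> R.
Hypothesis u01 : forall n, 0 <= u n <= 1.

Let ub_sdrop n : has_ubound (sdrop u n).
Proof. by exists 1 => _ [k _ <-]; case/andP: (u01 k). Qed.

Let lb_sdrop n : has_lbound (sdrop u n).
Proof. by exists 0 => _ [k _ <-]; case/andP: (u01 k). Qed.

Let sups_ge0 n : 0 <= sups u n.
Proof.
have /andP[un0 _] := u01 n.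
by apply: le_trans un0 _; apply: ub_le_sup => //; exists n => /=.
Qed.

Let infs_le1 n : infs u n <= 1.
Proof.
have /andP[_ un1] := u01 n.
by apply: le_trans un1; apply: ge_inf => //; exists n => /=.
Qed.

Let ubr : has_ubound (range u).
Proof. by exists 1 => _ [n _ <-]; case/andP: (u01 n). Qed.

Let lbr : has_lbound (range u).
Proof. by exists 0 => _ [n _ <-]; case/andP: (u01 n). Qed.

Let bfun : bounded_fun u.
Proof.
exists 1; split => // r r1 n _; have /andP[a b] := u01 n.
by rewrite /= ger0_norm// (le_trans b)// ltW.
Qed.

Let limsupE : limn_sup u = inf (range (sups u)).
Proof. exact: limn_supE. Qed.

Let liminfE : limn_inf u = sup (range (infs u)).
Proof. exact: limn_infE. Qed.

Lemma limn_sup_le c : (forall e, 0 < e -> exists N, forall n, (N <= n)%N -> u n <= c + e) ->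
  limn_sup u <= c.
Proof.
move=> H; apply/ler_addgt0Pr => e e0; have [N HN] := H e e0.
rewrite limsupE; apply: (@le_trans _ _ (sups u N)).
  by apply: ge_inf; [exists 0 => _ [n _ <-]|exists N].
apply: ge_sup => [|_ [n /= Nn <-]]; last exact: HN.
by exists (u N), N => /=.
Qed.

Lemma limn_sup_ge c : (forall e, 0 < e -> forall N, exists2 n, (N <= n)%N & c <= u n + e) ->
  c <= limn_sup u.
Proof.
move=> H; rewrite limsupE; apply: lb_le_inf; first by exists (sups u 0%N), 0%N.
move=> _ [N _ <-]; apply/ler_addgt0Pr => e e0; have [n Nn Hn] := H e e0 N.
apply: le_trans Hn _; rewrite lerD2r.
by apply: ub_le_sup => //; exists n.
Qed.

Lemma limn_inf_ge c : (forall e, 0 < e -> exists N, forall n, (N <= n)%N -> c <= u n + e) ->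
  c <= limn_inf u.
Proof.
move=> H; apply/ler_addgt0Pr => e e0; have [N HN] := H e e0.
rewrite liminfE -lerBlDr; apply: (@le_trans _ _ (infs u N)); last first.
  by apply: ub_le_sup; [exists 1 => _ [n _ <-]|exists N].
apply: lb_le_inf => [|_ [n /= Nn <-]]; last by rewrite lerBlDr; exact: HN.
by exists (u N), N => /=.
Qed.

Lemma limn_inf_le c : (forall e, 0 < e -> forall N, exists2 n, (N <= n)%N & u n <= c + e) ->
  limn_inf u <= c.
Proof.
move=> H; rewrite liminfE; apply: ge_sup; first by exists (infs u 0%N), 0%N.
move=> _ [N _ <-]; apply/ler_addgt0Pr => e e0; have [n Nn Hn] := H e e0 N.
apply: le_trans Hn.
by apply: ge_inf => //; exists n.
Qed.

Lemma limn_sup_eventually e : 0 < e ->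
  exists N, forall n, (N <= n)%N -> u n <= limn_sup u + e.
Proof.
move=> e0; apply: contrapT => /forallNP H.
suff : limn_sup u + e <= limn_sup u by rewrite gerDl leNgt e0.
apply: limn_sup_ge => e' e'0 N; have /existsNP[n /not_implyP[Nn Hn]] := H N.
exists n => //; apply: ltW; rewrite ltNge; apply/negP => Hn'; apply: Hn.
by apply: le_trans Hn'; rewrite lerDl ltW.
Qed.

Lemma limn_sup_frequently e N : 0 < e -> exists2 n, (N <= n)%N & limn_sup u - e <= u n.
Proof.
move=> e0; apply: contrapT => /forall2NP H.
suff : limn_sup u <= limn_sup u - e by rewrite lerBrDr gerDl leNgt e0.
apply: limn_sup_le => e' e'0; exists N => n Nn.
have [//|/negP] := H n; rewrite -ltNge => /ltW Hn.
by apply: le_trans Hn _; rewrite lerDl ltW.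
Qed.

End UnitInterval.

Definition sublinear (b : nat -> R) :=
  forall e, 0 < e -> exists N, forall n, (N <= n)%N -> b n <= e * n%:R.

Lemma sublinearD b b' : sublinear b -> sublinear b' -> sublinear (fun n => b n + b' n).
Proof.
move=> hb hb' e e0; have e20 : 0 < e / 2 by rewrite divr_gt0.
have [N HN] := hb _ e20; have [N' HN'] := hb' _ e20.
exists (maxn N N') => n; rewrite geq_max => /andP[/HN H /HN' H'].
by apply: le_trans (lerD H H') _; rewrite -mulrDl -splitr.
Qed.

Lemma sublinearZ c b : 0 <= c -> sublinear b -> sublinear (fun n => c * b n).
Proof.
move=> c0 hb e e0; have [N HN] := hb (e / (c + 1)) (divr_gt0 e0 (ltr_wpDl c0 ltr01)).
exists N => n /HN H; apply: le_trans (ler_wpM2l c0 H) _.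
rewrite mulrA ler_wpM2r// mulrCA ler_piMr ?(ltW e0)// ler_pdivrMr ?mul1r ?lerDl//.
by rewrite ltr_wpDl.
Qed.

(** Here [a] is the prescribed count, [w] the observed one, [th] the frequency of the unwanted
    surplus of [w] over [a], and [b] a sublinear error. *)
Lemma density_bounds (p q th : R) (w : nat -> nat) (a b : nat -> R) :
  0 <= th -> sublinear b -> (forall n, (w n <= n)%N) ->
  (forall n, a n <= q * n%:R + b n) -> (forall n, p * n%:R <= a n + b n) ->
  (forall N, exists2 n, (N <= n)%N & q * n%:R <= a n + b n) ->
  (forall N, exists2 n, (N <= n)%N & a n <= p * n%:R + b n) ->
  (forall n, (w n)%:R <= a n + th * n%:R + b n) -> (forall n, a n <= (w n)%:R + b n) ->
  let u := fun n => (w n)%:R / n%:R in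
  q <= limn_sup u <= q + th /\ p <= limn_inf u <= p + th.
Proof.
move=> th0 sb wn aq pa fq fp wa aw u.
have u01 n : 0 <= u n <= 1.
  rewrite /u divr_ge0//=; case: n => [|n]; first by rewrite invr0 mulr0.
  by rewrite ler_pdivrMr// mul1r ler_nat.
have key e : 0 < e -> exists N, forall n, (N <= n)%N -> 0 < n%:R :> R /\ b n + b n <= e * n%:R.
  move=> e0; have [N HN] := sublinearD sb sb e0.
  by exists (maxn N 1) => n; rewrite geq_max => /andP[/HN ? n0]; rewrite ltr0n.
split; apply/andP; split.
- apply: limn_sup_ge => // e e0 N; have [M HM] := key e e0; have [n Nn Hn] := fq (maxn N M).
  move: Nn; rewrite geq_max => /andP[Nn /HM [n0 bn]]; exists n => //.
  rewrite -lerBlDr /u ler_pdivlMr//; have := aw n; lra.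
- apply: limn_sup_le => // e e0; have [M HM] := key e e0; exists M => n /HM[n0 bn].
  rewrite /u ler_pdivrMr//; have := wa n; have := aq n; lra.
- apply: limn_inf_ge => // e e0; have [M HM] := key e e0; exists M => n /HM[n0 bn].
  rewrite -lerBlDr /u ler_pdivlMr//; have := aw n; have := pa n; lra.
- apply: limn_inf_le => // e e0 N; have [M HM] := key e e0; have [n Nn Hn] := fp (maxn N M).
  move: Nn; rewrite geq_max => /andP[Nn /HM [n0 bn]]; exists n => //.
  rewrite /u ler_pdivrMr//; have := wa n; lra.
Qed.

End LimSupInf.

Section Windows.
Context {R : realType} {K : nat}.
Hypothesis hK : (2 <= K)%N.
Local Notation T := (full_shift R K).
Implicit Types z : T * T.

Definition agree z i : bool := z.1 i == z.2 i.

Definition window z L i : bool := [forall j : 'I_L, agree z (i + j)].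

Lemma windowP z L i : reflect (forall j, (j < L)%N -> agree z (i + j)) (window z L i).
Proof.
apply: (iffP forallP) => [H j jL|H j]; first exact: (H (Ordinal jL)).
exact: H.
Qed.

Definition windows z L n : nat := (\sum_(0 <= i < n) window z L i)%N.

Lemma windows_le z L n : (windows z L n <= n)%N.
Proof.
rewrite -[leqRHS](subn0 n) -[leqRHS]muln1 -sum_nat_const_nat.
by apply: leq_sum => i _; exact: leq_b1.
Qed.

Lemma iter_shift (x : T) i j : iter i (@shift_map R K) x j = x (i + j)%N.
Proof. by elim: i j => //= i IH j; rewrite /shift_map IH addSnnS. Qed.

Lemma mdist_window z L i :
  (mdist (iter i (@shift_map R K) z.1) (iter i (@shift_map R K) z.2) < K%:R ^- L :> R) =
  window z L.+1 i.
Proof.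
apply/idP/idP => [/(mdist_shift_lt hK) H|/windowP H].
  by apply/windowP => j jL; rewrite /agree -!iter_shift H.
by apply/(mdist_shift_lt hK) => j jL; rewrite !iter_shift; apply/eqP; exact: H.
Qed.

Definition proximal z (e : R) n : nat :=
  (\sum_(0 <= i < n) (mdist (iter i (@shift_map R K) z.1) (iter i (@shift_map R K) z.2) < e)%R)%N.

Lemma prox_freqE z e n :
  prox_freq (@shift_map R K) z.1 z.2 e n = (proximal z e n)%:R / n%:R.
Proof. by rewrite /prox_freq /proximal -sum1_card big_mkcond/= big_mkord. Qed.

Lemma proximalE z L n : proximal z (K%:R ^- L) n = windows z L.+1 n.
Proof. by apply: eq_bigr => i _; rewrite mdist_window. Qed.

Lemma proximal_mono z n : {homo (fun e => proximal z e n) : e e' / e <= e' >-> (e <= e')%N}.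
Proof.
move=> e e' ee'; apply: leq_sum => i _.
by case: ltP => // /lt_le_trans ->.
Qed.

Lemma proximal_le z e n : (proximal z e n <= n)%N.
Proof.
rewrite -[leqRHS](subn0 n) -[leqRHS]muln1 -sum_nat_const_nat.
by apply: leq_sum => i _; exact: leq_b1.
Qed.

End Windows.

(** * Runs of agreement, and the sets D for q < 1 *)

Section Runs.
Context {R : realType} {K : nat}.
Local Notation T := (full_shift R K).
Local Notation A := ('I_K * 'I_K)%type.
Implicit Types (z : T * T) (s : seq A).

(** Capping at [L] leaves finitely many states; the state [L] says that a window of length [L] has
    just been completed. *)
Fixpoint run (L : nat) s : nat :=
  if s is a :: s' then if a.1 == a.2 then minn L (run L s').+1 else 0%N else 0%N.

Lemma run_le L s : (run L s <= L)%N.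
Proof. by case: s => //= a s; case: ifP => // _; exact: geq_minl. Qed.

Lemma windowS z L i : window z L.+1 i = window z L i && agree z (i + L).
Proof.
apply/windowP/andP => [H|[/windowP H HL] j].
  by split; [apply/windowP => j jL; apply: H; exact: ltnW|exact: H].
by rewrite ltnS leq_eqVlt => /orP[/eqP->|/H].
Qed.

Lemma window0 z i : window z 0 i.
Proof. by apply/windowP. Qed.

Lemma le_run_pre z L m n : (m <= L)%N ->
  (m <= run L (pre (pairs z) n))%N = (m <= n)%N && window z m (n - m).
Proof.
elim: n m => [|n IH] [|m] mL /=; rewrite ?window0//.
rewrite -/(agree z n) subSS windowS ltnS.
have [mn|nm] := leqP m n; last first.
  case: ifP => // _; rewrite leq_min mL/= ltnS; rewrite IH ?(ltnW mL)//.
  by rewrite leqNgt nm.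
rewrite subnK//; case: ifP => agn; last by rewrite andbF.
by rewrite leq_min mL/= ltnS IH ?(ltnW mL)// mn andbT.
Qed.

Lemma run_pre_max z L n : (run L (pre (pairs z) n) == L) = (L <= n)%N && window z L (n - L).
Proof. by rewrite eqn_leq run_le/= le_run_pre. Qed.

(** Passing from the end of a window to its start shifts time by [L], and no run is full before time
    [L]. The predicate [P] serves to test the letter that follows the window. *)
Lemma sum_run_max z L m (P : pred nat) :
  (\sum_(0 <= i < m + L) ((run L (pre (pairs z) i) == L) && P i) =
   \sum_(0 <= i < m) (window z L i && P (i + L)%N))%N.
Proof.
rewrite addnC (big_cat_nat (leq0n L) (leq_addr m L))/=.
rewrite big_nat_cond big1 ?add0n; last first.
  by move=> i /andP[/andP[_ iL] _]; rewrite run_pre_max leqNgt iL.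
rewrite -{1}[L]add0n big_addn addKn; apply: eq_bigr => i _.
by rewrite run_pre_max leq_addl addnK.
Qed.

Lemma sum_pairs (F : pzRingType) (x y : F) :
  \sum_(a : A) (if a.1 == a.2 then x else y) = K%:R * x + (K%:R * K%:R - K%:R) * y.
Proof.
have KK : (K <= K * K)%N by case: K => // n; rewrite leq_pmull.
rewrite -natrM -natrB// !mulr_natl.
rewrite -(pair_bigA _ (fun i j : 'I_K => if i == j then x else y))/=.
have E (i : 'I_K) : \sum_j (if i == j then x else y) = x + y *+ K.-1.
  rewrite (bigD1 i)//= eqxx; congr (_ + _).
  rewrite (eq_bigr (fun=> y)); last by move=> j /negbTE; rewrite eq_sym => ->.
  by rewrite sumr_const cardC1 card_ord.
rewrite (eq_bigr _ (fun i _ => E i)) sumr_const card_ord mulrnDl; congr (_ + _).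
by rewrite -mulrnA -subn1 mulnBl mul1n.
Qed.

End Runs.

(** * A Markov mass that favours few and long agreements *)

Section PersistentRuns.
Context {R : realType} {K : nat}.
Hypothesis hK : (2 <= K)%N.
Local Notation T := (full_shift R K).
Local Notation A := ('I_K * 'I_K)%type.
Implicit Types (z : T * T) (s : seq A).
Local Notation k := (K%:R : R).

Variable L : nat.
Hypothesis L_gt0 : (0 < L)%N.

Let h : R := k ^- L.
(** For a uniform pair, killed when a run of length [L] completes, the mean of [run_potential] drops
    by exactly [d] per step. The factor [1 / lam] spends one half of this drop, and the entrance
    weight [tau / k] at most the other half. *)
Let d : R := h * (1 - k^-1).
Let lam : R := 1 - d / 2.
Variable tau : R.
Hypothesis tau_gt0 : 0 < tau.
Hypothesis tau_small : tau <= k * d / 2.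

Let k2 : 2 <= k. Proof. by rewrite ler_nat. Qed.
Let k0 : 0 < k. Proof. exact: K_gt0. Qed.
Let kV0 : 0 < k^-1. Proof. by rewrite invr_gt0. Qed.
Let kV2 : k^-1 <= 2^-1. Proof. by rewrite lef_pV2// posrE. Qed.
Let h0 : 0 < h. Proof. by rewrite invr_gt0 exprn_gt0. Qed.
Let hk : h <= k^-1.
Proof.
rewrite /h lef_pV2 ?posrE ?exprn_gt0// -[leLHS]expr1 ler_weXn2l//.
by have := k2; lra.
Qed.
Let d0 : 0 < d. Proof. by rewrite mulr_gt0//; have := kV2; lra. Qed.
Let dh : d <= h. Proof. by rewrite /d; have := mulr_gt0 h0 kV0; lra. Qed.
Let lam0 : 0 < lam.
Proof. by rewrite /lam; have := dh; have := hk; have := kV2; lra. Qed.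
Let tau1 : tau < 1.
Proof.
have : k * d <= 1 - k^-1.
  by rewrite /d mulrA; apply: ler_piMl; [have := kV2; lra|rewrite -ler_pdivlMl// mulr1].
by have := tau_small; have := kV0; lra.
Qed.

(** State [L] is almost always kept, entering or leaving it costs a factor [tau], and every other
    step has the uniform weight [k^-2] raised by [1 / lam], which is the gain in entropy. *)
Definition step_weight (r : nat) (a : A) : R :=
  if a.1 == a.2 then
    if r == L then (1 - tau) / k else if r.+1 == L then tau / k ^+ 2 else (k ^+ 2 * lam)^-1
  else if r == L then tau / k ^+ 2 else (k ^+ 2 * lam)^-1.

(* For [r < L] this is a strictly superharmonic function of the run-length chain of
   a uniform pair killed when a run of length [L] completes; the strictness
   leaves room for the factor [lam < 1]. *)
Definition run_potential (r : nat) : R := if r == L then 1 else 1 - k ^+ r * h.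

Fixpoint run_weight s : R :=
  if s is a :: s' then step_weight (run L s') a * run_weight s' else 1.

(** Below state [L - 1] the step weights add up to [1 / lam > 1]; the potential compensates for
    this. *)
Definition tilted s : R := run_weight s * run_potential (run L s).

Lemma step_weight_gt0 r a : 0 < step_weight r a.
Proof.
have k20 : 0 < k ^+ 2 by rewrite exprn_gt0.
have H1 : 0 < (1 - tau) / k by rewrite divr_gt0// subr_gt0.
have H2 : 0 < tau / k ^+ 2 by rewrite divr_gt0.
have H3 : 0 < (k ^+ 2 * lam)^-1 by rewrite invr_gt0 mulr_gt0.
by rewrite /step_weight; repeat case: ifP => //.
Qed.

Lemma run_weight_gt0 s : 0 < run_weight s.
Proof. by elim: s => //= a s IH; rewrite mulr_gt0// step_weight_gt0. Qed.

Lemma run_potential_ge r : (r <= L)%N -> 1 - k^-1 <= run_potential r.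
Proof.
move=> rL; rewrite /run_potential; case: eqP => [_|/eqP rnL]; first by have := kV0; lra.
rewrite lerD2l lerN2 /h ler_pdivrMr ?exprn_gt0// mulrC ler_pdivlMr// -exprSr.
by rewrite ler_weXn2l ?ltn_neqAle ?rnL//; have := k2; lra.
Qed.

Lemma run_potential_harm r : (r <= L)%N ->
  \sum_(a : A) step_weight r a * run_potential (if a.1 == a.2 then minn L r.+1 else 0%N)
    <= run_potential r.
Proof.
move=> rL.
have -> : \sum_(a : A) step_weight r a * run_potential (if a.1 == a.2 then minn L r.+1 else 0%N) =
  \sum_(a : A) (if a.1 == a.2 then
    (if r == L then (1 - tau) / k else if r.+1 == L then tau / k ^+ 2 else (k ^+ 2 * lam)^-1)
      * run_potential (minn L r.+1)
    else (if r == L then tau / k ^+ 2 else (k ^+ 2 * lam)^-1) * run_potential 0).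
  by apply: eq_bigr => a _; rewrite /step_weight; case: ifP.
rewrite sum_pairs.
have P0 : run_potential 0 = 1 - h by rewrite /run_potential eq_sym gtn_eqF// expr0 mul1r.
have kn0 : k != 0 by rewrite gt_eqF.
have ln0 : lam != 0 by rewrite gt_eqF.
rewrite P0; have [->|rnL] := eqVneq r L.
  rewrite /run_potential (minn_idPl _)// eqxx.
  have -> : k * ((1 - tau) / k * 1) + (k * k - k) * (tau / k ^+ 2 * (1 - h)) =
     1 - tau + tau * ((1 - k^-1) * (1 - h)) by field.
  suff : (1 - k^-1) * (1 - h) <= 1 by move/(ler_wpM2l (ltW tau_gt0)); lra.
  by apply: mulr_ile1; have := kV0; have := kV2; have := hk; have := h0; lra.
have rltL : (r < L)%N by rewrite ltn_neqAle rnL.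
rewrite (minn_idPr _)//.
have [rL1|rnL1] := eqVneq r.+1 L.
  have -> : run_potential r.+1 = 1 by rewrite /run_potential rL1 eqxx.
  have -> : run_potential r = 1 - k^-1.
    rewrite /run_potential (negbTE rnL) /h -rL1; congr (_ - _).
    by rewrite exprS invfM mulrCA mulfV ?mulr1// expf_neq0.
  have -> : k * (tau / k ^+ 2 * 1) + (k * k - k) * ((k ^+ 2 * lam)^-1 * (1 - h)) =
     tau / k + (1 - k^-1) * (1 - h) / lam by field; rewrite ?kn0 ?ln0.
  have tk : tau / k <= d / 2 by rewrite ler_pdivrMr//; have := tau_small; lra.
  rewrite -lerBrDl ler_pdivrMr//.
  have E : (1 - k^-1) * (1 - h) = 1 - k^-1 - d by rewrite /d; ring.
  rewrite E /lam.
  have Q0 : 0 <= (1 - k^-1 - tau / k) by have := dh; have := hk; have := kV2; lra.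
  have : d / 2 * (1 - k^-1 - tau / k) <= d / 2 * 1.
    apply: ler_wpM2l; first by have := d0; lra.
    have tk0 : 0 < tau / k by rewrite divr_gt0.
    by have := kV0; lra.
  lra.
rewrite /run_potential (negbTE rnL) (negbTE rnL1).
have -> : k * ((k ^+ 2 * lam)^-1 * (1 - k ^+ r.+1 * h)) +
    (k * k - k) * ((k ^+ 2 * lam)^-1 * (1 - h)) =
  (1 - k ^+ r * h - d) / lam by rewrite /d [k ^+ r.+1]exprS; field; rewrite ?kn0 ?ln0.
rewrite ler_pdivrMr// /lam.
have := mulr_ge0 (ltW d0) (mulr_ge0 (exprn_ge0 r (ltW k0)) (ltW h0)).
by have := d0; lra.
Qed.

Lemma tilted_submass : submass (EFin \o tilted).
Proof.
apply: submass_EFin => s.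
  rewrite mulr_ge0 ?(ltW (run_weight_gt0 _))//.
  by apply: le_trans (run_potential_ge (run_le L s)); have := kV2; lra.
rewrite /tilted (eq_bigr (fun a => run_weight s * (step_weight (run L s) a *
    run_potential (if a.1 == a.2 then minn L (run L s).+1 else 0%N)))); last first.
  by move=> a _ /=; rewrite [step_weight _ _ * _]mulrC -mulrA.
rewrite -mulr_sumr ler_wpM2l ?(ltW (run_weight_gt0 _))//.
exact: run_potential_harm (run_le L s).
Qed.

Lemma tilted_nil : tilted [::] <= 1.
Proof.
rewrite /tilted /= mul1r /run_potential eq_sym gtn_eqF// expr0 mul1r.
by have := h0; lra.
Qed.


Let stays z n : nat := (\sum_(0 <= i < n) ((run L (pre (pairs z) i) == L) && agree z i))%N.
Let exits z n : nat := (\sum_(0 <= i < n) ((run L (pre (pairs z) i) == L) && ~~ agree z i))%N.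

(** Entrances into state [L] alternate with exits, so they number [exits + b], where [b] tells
    whether the chain is in that state now: hence [2 * exits + b] factors [tau]. *)
Let ln_run_weight z n (b := run L (pre (pairs z) n) == L) :
  ln (run_weight (pre (pairs z) n)) =
  - (2 * n%:R * ln k) + (stays z n)%:R * (ln k + ln (1 - tau))
  + (2 * (exits z n)%:R + b%:R) * ln tau
  - (n%:R - (stays z n)%:R - 2 * (exits z n)%:R - b%:R) * ln lam.
Proof.
rewrite {}/b; elim: n => [|n IH].
  by rewrite /= /stays /exits !big_nil ln1 eq_sym gtn_eqF//=; ring.
have t1 : 0 < 1 - tau by rewrite subr_gt0.
have k20 : 0 < k ^+ 2 by rewrite exprn_gt0.
have lnk2 : ln (k ^+ 2) = 2 * ln k by rewrite lnXn// mulr_natl.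
rewrite [pre _ n.+1]/= [run_weight _]/= lnM ?posrE ?step_weight_gt0 ?run_weight_gt0//.
rewrite {}IH /stays /exits !big_nat_recr//= -/(stays z n) -/(exits z n) -/(agree z n) !natrD.
rewrite /step_weight -/(agree z n) -[n.+1%:R]natr1.
have [rL|rnL] := eqVneq (run L (pre (pairs z) n)) L.
  case: (agree z n); last first.
    rewrite eq_sym gtn_eqF//= ln_div ?posrE// lnk2; ring.
  by rewrite rL (minn_idPl _)// eqxx/= ln_div ?posrE//; ring.
case: (agree z n); last first.
  by rewrite [0%N == L]eq_sym gtn_eqF//= lnV ?posrE ?mulr_gt0// lnM ?posrE// lnk2; ring.
have rltL : (run L (pre (pairs z) n) < L)%N by rewrite ltn_neqAle rnL run_le.
rewrite (minn_idPr _)//; case: eqP => [_|_]/=.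
  by rewrite ln_div ?posrE// lnk2; ring.
by rewrite lnV ?posrE ?mulr_gt0// lnM ?posrE// lnk2; ring.
Qed.

Let staysE z m : stays z (m + L) = windows z L.+1 m.
Proof.
by rewrite /stays sum_run_max; apply: eq_bigr => i _; rewrite windowS.
Qed.

Let exitsE z m : (exits z (m + L) + windows z L.+1 m = windows z L m)%N.
Proof.
rewrite /exits sum_run_max /windows -big_split/=; apply: eq_bigr => i _.
by rewrite windowS; case: window; case: agree.
Qed.

(** At times [m] when the windows of length [L.+1] are almost [q * m] in number, those of length [L]
    can hardly be more, so exits are few. The logarithm of the weight is then [-(2 - q) * m * ln k]
    plus a gain of about [(1 - q) * m * - ln lam], of which staying in state [L] costs at most
    half. *)
Lemma tilted_growth z (q : R) : 0 <= q < 1 -> - ((1 - q) * - ln lam / 2) <= ln (1 - tau) ->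
  limn_sup (fun n => (windows z L n)%:R / n%:R : R) = q ->
  limn_sup (fun n => (windows z L.+1 n)%:R / n%:R : R) = q ->
  forall M n0, exists2 n, (n0 <= n)%N & M * (k ^- n) `^ (2 - q) <= tilted (pre (pairs z) n).
Proof.
move=> /andP[q0 q1] tauq HL HL1 M n0.
have u01 l n : 0 <= ((windows z l n)%:R : R) / n%:R <= (1 : R).
  rewrite divr_ge0//=; case: n => [|n]; first by rewrite invr0 mulr0.
  by rewrite ler_pdivrMr// mul1r ler_nat windows_le.
set ll := - ln lam in tauq.
have ll0 : 0 < ll by rewrite /ll oppr_gt0 ln_lt0// lam0/= /lam; have := d0; lra.
set t := - ln tau.
have t0 : 0 < t by rewrite /t oppr_gt0 ln_lt0// tau_gt0 tau1.
set kap := ln k.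
have kap0 : 0 < kap by rewrite ln_gt0// K_gt1.
(* [den] collects the coefficients of [eta] in the error terms, so that they consume a quarter of
   the gain; the remaining quarter absorbs the bounded terms gathered in [cst]. *)
pose den := kap + 4 * t + 5 * ll.
have den0 : 0 < den by rewrite /den; lra.
pose eta := (1 - q) * ll / (4 * den).
have eta0 : 0 < eta by rewrite divr_gt0// ?mulr_gt0// subr_gt0.
have etaE : eta * den = (1 - q) * ll / 4 by rewrite /eta; field; rewrite gt_eqF.
have [N HN] := limn_sup_eventually (u01 L) eta0.
pose M1 := Num.max M 1.
pose cst := kap * q * L%:R + t + ll + ln (2 * M1).
have [m0 Hm0] : exists m0 : nat, cst <= m0%:R * ((1 - q) * ll / 4).
  have c0 : 0 < (1 - q) * ll / 4 by rewrite divr_gt0// mulr_gt0// subr_gt0.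
  exists (Num.truncn (Num.max (cst / ((1 - q) * ll / 4)) 0)).+1.
  rewrite -ler_pdivrMr//; apply: ltW; apply: le_lt_trans (truncnS_gt _).
  by rewrite le_max lexx.
have [m Hm Hfreq] := limn_sup_frequently (u01 L.+1) (maxn (maxn N n0) (maxn m0 1)) eta0.
move: Hm; rewrite !geq_max => /andP[/andP[Nm n0m] /andP[m0m m1]].
exists (m + L)%N; first by rewrite (leq_trans n0m)// leq_addr.
have mp : 0 < m%:R :> R by rewrite ltr0n.
have wL := HN m Nm; rewrite HL ler_pdivrMr// in wL.
rewrite HL1 ler_pdivlMr// in Hfreq.
have wm : (windows z L.+1 m)%:R <= m%:R :> R by rewrite ler_nat windows_le.
have M10 : 0 < M1 by rewrite lt_max ltr01 orbT.
have pw0 : 0 < (k ^- (m + L)) `^ (2 - q) by rewrite powR_gt0// invr_gt0 exprn_gt0.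
have rw0 := run_weight_gt0 (pre (pairs z) (m + L)).
apply: (@le_trans _ _ (M1 * (k ^- (m + L)) `^ (2 - q))).
  by rewrite ler_pM2r// le_max lexx.
apply: (@le_trans _ _ (run_weight (pre (pairs z) (m + L)) * 2^-1)); last first.
  rewrite ler_pM2l//; apply: le_trans (run_potential_ge (run_le _ _)); have := kV2; lra.
rewrite ler_pdivlMr// mulrAC [_ * 2]mulrC -ler_ln ?posrE ?mulr_gt0//.
rewrite lnM ?posrE ?mulr_gt0// ln_powR lnV ?posrE ?exprn_gt0// lnXn// -/kap.
rewrite ln_run_weight -/kap staysE -[kap *+ _]mulr_natl.
have ex := exitsE z m; move/(congr1 (fun n => n%:R : R)): ex; rewrite natrD => ex.
set e := (exits z (m + L))%:R in ex *.
set w := (windows z L.+1 m)%:R in ex wm Hfreq *.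
set b := (_ == L)%:R.
have b1 : 0 <= b <= 1 by rewrite /b; case: (_ == L); rewrite ?lexx ?ler01.
have e0 : 0 <= e by rewrite /e.
have w0 : 0 <= w by rewrite /w.
have ex2 : e <= 2 * eta * m%:R by have := wL; lra.
have wu : w <= (q + eta) * m%:R by lra.
rewrite natrD.
have I1 : (q - eta) * m%:R * kap <= w * kap by rewrite ler_pM2r.
have I2 : - (m%:R * ((1 - q) * ll / 2)) <= w * ln (1 - tau).
  apply: (@le_trans _ _ (w * - ((1 - q) * ll / 2))); last by rewrite ler_wpM2l.
  by rewrite [w * - _]mulrN lerN2 ler_wpM2r// divr_ge0// mulr_ge0 ?subr_ge0 ?ltW.
have I3 : - ((4 * eta * m%:R + 1) * t) <= (2 * e + b) * ln tau.
  have -> : ln tau = - t by rewrite /t opprK.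
  rewrite [_ * - t]mulrN lerN2 ler_pM2r//; lra.
have I4 : (m%:R - (q + eta) * m%:R - 4 * eta * m%:R - 1) * ll
    <= - ((m%:R + L%:R - w - 2 * e - b) * ln lam).
  rewrite -[leRHS]mulrN -/ll ler_pM2r//; have : 0 <= (L%:R : R) by []; lra.
have I5 : cst <= m%:R * ((1 - q) * ll / 4).
  apply: le_trans Hm0 _; rewrite ler_pM2r ?ler_nat//.
  by rewrite divr_gt0// mulr_gt0// subr_gt0.
have I6 : eta * den * m%:R = (1 - q) * ll / 4 * m%:R by rewrite etaE.
rewrite /cst /den in I5 I6.
lra.
Qed.

End PersistentRuns.

Section DistributionFunctions.
Context {R : realType} {K : nat}.
Hypothesis hK : (2 <= K)%N.
Local Notation T := (full_shift R K).
Local Notation A := ('I_K * 'I_K)%type.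
Implicit Types (z : T * T).

Lemma upper_distE z L : upper_dist (@shift_map R K) z.1 z.2 (K%:R ^- L) =
  limn_sup (fun n => (windows z L.+1 n)%:R / n%:R : R).
Proof.
by congr limn_sup; apply/funext => n; rewrite prox_freqE proximalE.
Qed.

Lemma hausdorff_D_set_eq0 (p q : R) : 0 <= q < 1 ->
  hausdorff_measure (2 - q) (D_set (@shift_map R K) p q) = 0%E.
Proof.
move=> /andP[q0 q1].
pose d L : R := K%:R ^- L * (1 - K%:R^-1).
pose lam L : R := 1 - d L / 2.
(* The least value of [1 - tau] for which staying in state [L] costs no more than half of the
   gain. *)
pose low L := expR (- ((1 - q) * - ln (lam L) / 2)).
pose tau L := Num.min (K%:R * d L / 2) (1 - low L).
have k0 : 0 < K%:R :> R by exact: K_gt0.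
have k1 : K%:R^-1 < 1 :> R by rewrite invf_lt1// K_gt1.
have kV0 : 0 < K%:R^-1 :> R by rewrite invr_gt0.
have d0 L : 0 < d L by rewrite mulr_gt0 ?invr_gt0 ?exprn_gt0// subr_gt0.
have d1 L : d L <= 1.
  apply: mulr_ile1; rewrite ?invr_ge0 ?exprn_ge0 ?(ltW k0)//; try lra.
  by rewrite invf_le1 ?exprn_gt0// exprn_ege1// ltW// K_gt1.
have lam01 L : 0 < lam L < 1 by have := d0 L; have := d1 L; rewrite /lam; lra.
have low1 L : low L < 1.
  rewrite -[ltRHS]expR0 ltr_expR oppr_lt0 divr_gt0// mulr_gt0 ?subr_gt0// oppr_gt0.
  exact: ln_lt0.
have tau0 L : 0 < tau L by rewrite lt_min subr_gt0 low1 andbT divr_gt0// mulr_gt0.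
have tau_d L : tau L <= K%:R * d L / 2 by rewrite ge_min lexx.
apply: (@hausdorff_measure_eq0 _ _ hK _ (fun j => @tilted R K j.+1 (tau j.+1))).
- lra.
- by move=> j; exact: tilted_submass.
- by move=> j; exact: tilted_nil.
(* Both [K^-j] and [K^-(j+1)] are below [e0], so the windows of lengths [j.+1] and [j.+2] have the
   same upper frequency [q]. *)
move=> z [e0 e00 He]; have [j je] := expr_inv_small hK e00; exists j.
have pos n : 0 < K%:R ^- n :> R by rewrite invr_gt0 exprn_gt0.
have je1 : K%:R ^- j.+1 < K%:R ^- j :> R.
  by rewrite ltf_pV2 ?posrE ?exprn_gt0// ltr_eXn2l ?K_gt1.
apply: tilted_growth => //.
- by rewrite q0.
- rewrite -/(d j.+1) -/(lam j.+1) -[leLHS]expRK ler_ln ?posrE ?expR_gt0//.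
    by rewrite -/(low j.+1) lerBrDl -lerBrDr ge_min lexx orbT.
  rewrite subr_gt0; apply: (@le_lt_trans _ _ (1 - low j.+1)); first by rewrite ge_min lexx orbT.
  by have := expR_gt0 (- ((1 - q) * - ln (lam j.+1) / 2)); rewrite -/(low j.+1); lra.
- rewrite -upper_distE; apply: (He _ _).1; rewrite pos ltW//.
- rewrite -upper_distE; apply: (He _ _).1; rewrite pos ltW//; exact: lt_trans je.
Qed.

End DistributionFunctions.

(** * Typical pairs with prescribed frequencies *)

Section Blocks.
Local Open Scope nat_scope.

(* [blk i] is the integer square root of [i]: the block [k] is [k^2, (k+1)^2). *)
Fixpoint blk (i : nat) : nat :=
  if i is i'.+1 then if (blk i').+1 ^ 2 == i then (blk i').+1 else blk i' else 0%N.

Definition is_square i : bool := blk i ^ 2 == i.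

Lemma sqnS k : k.+1 ^ 2 = k ^ 2 + k.*2.+1.
Proof. by rewrite -addn1 sqrnD muln1 -mul2n exp1n -addnA add1n. Qed.

Lemma leq_sqn k : k <= k ^ 2.
Proof. by case: k => // k; rewrite -mulnn leq_pmulr. Qed.

Lemma blk_bounds i : (blk i ^ 2 <= i < (blk i).+1 ^ 2)%N.
Proof.
elim: i => //= i /andP[H1 H2]; case: eqP => [E|/eqP E].
  by rewrite E leqnn/= -[X in (X < _)%N]E ltn_exp2r.
by rewrite ltn_neqAle eq_sym E H2 ltnW// ltnW.
Qed.

Lemma blk_sq k : blk (k ^ 2) = k.
Proof.
have /andP[H1 H2] := blk_bounds (k ^ 2); apply/eqP; rewrite eqn_leq.
by rewrite leq_exp2r// in H1; rewrite ltn_exp2r// ltnS in H2; rewrite H1 H2.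
Qed.

Lemma blkS i : (blk i.+1 = blk i + is_square i.+1)%N.
Proof.
rewrite /is_square /=; case: eqP => [E|/eqP E]; first by rewrite E eqxx addn1.
suff /negbTE -> : blk i ^ 2 != i.+1 by rewrite addn0.
by have /andP[H _] := blk_bounds i; rewrite neq_ltn ltnS H.
Qed.

Lemma leq_blk : {homo blk : i j / (i <= j)%N}.
Proof.
apply: homo_leq => // [i j k|i]; first exact: leq_trans.
by rewrite blkS leq_addr.
Qed.

Lemma blkD_le i j : (blk (i + j) <= blk i + j)%N.
Proof.
elim: j => [|j IH]; first by rewrite !addn0.
by rewrite !addnS blkS -[leqRHS]addn1 leq_add// leq_b1.
Qed.

Lemma sum_squares n : ((\sum_(0 <= i < n) is_square i) + is_square n = (blk n).+1)%N.
Proof.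
elim: n => [|n IH]; first by rewrite big_nil.
by rewrite big_nat_recr//= IH addSn -blkS.
Qed.

Lemma blk_id_ge j i : (j ^ 2 <= i)%N -> (j <= blk i)%N.
Proof. by move=> /leq_blk; rewrite blk_sq. Qed.

(** A change raises [blk] by at least 1, and the sum of [blk (i + L) - blk i] telescopes to at most
    [L] terms, each at most [blk n + L]. *)
Lemma blk_change L n :
  ((\sum_(0 <= i < n) (blk (i + L) != blk i)) <= L * (blk n + L))%N.
Proof.
rewrite -(leq_add2r (\sum_(0 <= i < n) blk i)%N) -big_split/=.
apply: (@leq_trans (\sum_(0 <= i < n + L) blk i)%N).
  apply: (@leq_trans (\sum_(0 <= i < n) blk (i + L))%N).
    apply: leq_sum => i _; have := leq_blk (leq_addr L i).
    by rewrite leq_eqVlt eq_sym; case: eqP => [->|_ /=]; rewrite ?eqxx//.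
  rewrite addnC (big_cat_nat (leq0n L) (leq_addr n L))/=.
  suff -> : \sum_(L <= i < L + n) blk i = \sum_(0 <= i < n) blk (i + L) by rewrite leq_addl.
  by rewrite -{1}[L]add0n big_addn addKn.
rewrite (big_cat_nat (leq0n n) (leq_addr L n))/= addnC leq_add2r.
apply: (@leq_trans (\sum_(n <= i < n + L) (blk n + L))%N).
  rewrite big_nat [leqRHS]big_nat; apply: leq_sum => i /andP[_ iL].
  by apply: leq_trans (blkD_le n L); apply: leq_blk; exact: ltnW.
by rewrite sum_nat_const_nat addKn.
Qed.

End Blocks.

(** * A union of blocks with lower density [p] and upper density [q] *)

Section Density.
Context {R : realType}.
Variables (p q : R).
Hypotheses (p_ge0 : 0 <= p) (p_le_q : p <= q) (q_le1 : q <= 1).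

(** Constant for [k] from [2^(2^j)] up to its square, so that each phase outweighs everything before
    it. *)
Definition target (k : nat) : R := if odd (trunc_log 2 (trunc_log 2 k)) then q else p.

(* Staying [k] below the target frequency at the end of block [k] is what makes
   the Hausdorff measure infinite when [0 < q]. *)
Fixpoint included_upto (k : nat) : nat :=
  if k is j.+1 then
    if ((included_upto j + j.*2.+1)%:R <= target j * (j ^ 2)%:R - j%:R :> R)
    then (included_upto j + j.*2.+1)%N else included_upto j
  else 0%N.

Definition included (k : nat) : bool :=
  (included_upto k + k.*2.+1)%:R <= target k * (k ^ 2)%:R - k%:R :> R.

Definition dens (n : nat) : nat := (\sum_(0 <= i < n) included (blk i))%N.

Let q0 : 0 <= q. Proof. exact: le_trans p_le_q. Qed.
Let p1 : p <= 1. Proof. exact: le_trans q_le1. Qed.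

Let target_le k : target k <= q. Proof. by rewrite /target; case: ifP. Qed.
Let target_ge k : p <= target k. Proof. by rewrite /target; case: ifP. Qed.

Let included_uptoS k :
  included_upto k.+1 = (included_upto k + included k * k.*2.+1)%N.
Proof. by rewrite /= -/(included k); case: included; rewrite ?mul1n ?addn0. Qed.

Let dbl k : k.*2.+1%:R = 2 * k%:R + 1 :> R.
Proof. by rewrite -natr1 -mul2n natrM. Qed.

Let sqS k : (k.+1 ^ 2)%:R = (k ^ 2)%:R + 2 * k%:R + 1 :> R.
Proof. by rewrite !natrX -natr1; ring. Qed.

Let sq_ge0 k : 0 <= (k ^ 2)%:R :> R. Proof. by []. Qed.
Let k_ge0 k : 0 <= k%:R :> R. Proof. by []. Qed.

Let p_dbl k (r : R) : r <= 1 -> r * (2 * k%:R + 1) <= 2 * k%:R + 1.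
Proof. by move=> r1; rewrite ler_piMl// addr_ge0// mulr_ge0. Qed.

Let includedP k : included k ->
  (included_upto k)%:R + 2 * k%:R + 1 <= target k * (k ^ 2)%:R - k%:R.
Proof. by rewrite /included natrD dbl addrA. Qed.

Let excludedP k : ~~ included k ->
  target k * (k ^ 2)%:R - k%:R <= (included_upto k)%:R + 2 * k%:R + 1.
Proof. by rewrite /included -ltNge natrD dbl addrA => /ltW. Qed.

Let densE n : dens n = (included_upto (blk n) + included (blk n) * (n - blk n ^ 2))%N.
Proof.
elim: n => [|n IH]; first by rewrite /dens big_nil/= muln0.
rewrite /dens big_nat_recr//= -/(dens n) IH -/(blk n.+1).
have /andP[H1 H2] := blk_bounds n.
rewrite blkS /is_square; case: eqP => [E|E].
  move: E; rewrite {1}blkS /is_square; case: eqP => [_ E|_]; last first.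
    by rewrite addn0 => E; move: H1; rewrite E ltnn.
  rewrite addn1 in E *; rewrite included_uptoS E subnn muln0 addn0 -addnA; congr addn.
  have -> : (n - blk n ^ 2 = (blk n).*2)%N.
    by move: E; rewrite sqnS addnS => -[E]; rewrite -{1}E addKn.
  by case: included; rewrite ?mul1n ?addn1.
rewrite addn0 subSn// -addnA; congr addn.
by case: included; rewrite ?mul1n ?addn1.
Qed.

Let upto_le_sq k : (included_upto k <= k ^ 2)%N.
Proof.
elim: k => // k IH; rewrite included_uptoS.
apply: leq_trans (leq_add IH _ : _ <= k ^ 2 + k.*2.+1)%N _.
  by case: included; rewrite ?mul1n.
by rewrite sqnS.
Qed.

Let cap k n : (k ^ 2 <= n)%N ->
  q * (k ^ 2)%:R - k%:R <= q * n%:R - k%:R.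
Proof. by move=> kn; rewrite lerD2r ler_wpM2l// ler_nat. Qed.

(** The bound never decreases: if [q * k^2 - k] is positive then [q * k >= 1], so its next increment
    [q * (2 * k + 1) - 1] is nonnegative. *)
Let upto_le k : (included_upto k)%:R <= Num.max 0 (q * (k ^ 2)%:R - k%:R).
Proof.
elim: k => [|k IH]; first by rewrite le_max lexx.
rewrite included_uptoS natrD natrM; have [/includedP H|_] := boolP (included k).
  rewrite mul1r dbl addrA (le_trans H)//.
  have H1 : target k * (k ^ 2)%:R <= q * (k ^ 2)%:R by rewrite ler_wpM2r.
  rewrite le_max orbC; apply/orP; left.
  rewrite sqS -[k.+1%:R]natr1.
  have : 1 <= q * (2 * k%:R + 1).
    have Q0 : 0 < q * (k ^ 2)%:R.
      by have := k_ge0 k; have : 0 <= (included_upto k)%:R :> R; [by []|lra].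
    have K1 : 1 <= k%:R :> R.
      by rewrite ler1n lt0n; apply: contraTneq Q0 => ->; rewrite mulr0 ltxx.
    have Qk : 1 * k%:R <= q * k%:R * k%:R.
      rewrite mul1r -mulrA -natrM mulnn.
      by have : 0 <= (included_upto k)%:R :> R; [by []|lra].
    have : 1 <= q * k%:R by rewrite -(ler_pM2r (lt_le_trans ltr01 K1)).
    by have := q0; lra.
  lra.
rewrite mul0r addr0 (le_trans IH)// ge_max le_max lexx/= le_max.
have [le0|gt0] := lerP (q * (k ^ 2)%:R - k%:R) 0; first by [].
apply/orP; right; rewrite sqS -[k.+1%:R]natr1.
have K1 : 1 <= k%:R :> R.
  by rewrite ler1n lt0n; apply: contraTneq gt0 => ->; rewrite mulr0 subrr ltxx.
have Qk : 1 * k%:R <= q * k%:R * k%:R.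
  by rewrite mul1r -mulrA -natrM mulnn; lra.
have : 1 <= q * k%:R by rewrite -(ler_pM2r (lt_le_trans ltr01 K1)).
by have := q0; lra.
Qed.

(** The inclusion test counts the whole block in advance, so the bound also holds in the middle of
    an included block. *)
Lemma dens_le n : (dens n)%:R <= Num.max 0 (q * n%:R - (blk n)%:R) :> R.
Proof.
have /andP[H1 H2] := blk_bounds n.
have := cap H1; rewrite densE; have [/includedP H c|_ c] := boolP (included (blk n)).
  rewrite le_max mul1n natrD; apply/orP; right.
  have : (n - blk n ^ 2)%:R <= 2 * (blk n)%:R + 1 :> R.
    by rewrite -dbl ler_nat leq_subLR -sqnS ltnW.
  have H3 : target (blk n) * (blk n ^ 2)%:R <= q * (blk n ^ 2)%:R by rewrite ler_wpM2r.
  lra.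
rewrite mul0n addn0 (le_trans (upto_le _))// ge_max le_max lexx/= le_max.
by rewrite c orbT.
Qed.

(** An included block adds at least its share [r * (2 * k + 1)]; an excluded one shows that the
    count is already within [O(k)] of the target. *)
Let upto_ge (r : R) k0 k : 0 <= r -> r <= 1 -> (k0 <= k)%N ->
  (forall j, (k0 <= j < k)%N -> r <= target j) ->
  r * ((k ^ 2)%:R - (k0 ^ 2)%:R) <= (included_upto k)%:R + 5 * k%:R + 2.
Proof.
move=> r0 r1; elim: k => [|k IH].
  rewrite leqn0 => /eqP -> _; rewrite subrr mulr0 mulr0 addr0 add0r//.
rewrite leq_eqVlt => /predU1P[-> _|]; first by rewrite subrr mulr0 addr_ge0// addr_ge0// mulr_ge0.
rewrite ltnS => k0k Hj.
have rk : r <= target k by apply: Hj; rewrite k0k ltnSn.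
have {}IH : r * ((k ^ 2)%:R - (k0 ^ 2)%:R) <= (included_upto k)%:R + 5 * k%:R + 2.
  by apply: IH => // j /andP[k0j jk]; apply: Hj; rewrite k0j ltnW.
have D := p_dbl k r1.
rewrite included_uptoS natrD natrM sqS -[k.+1%:R]natr1.
have [_|/excludedP H] := boolP (included k).
  by rewrite mul1r dbl; lra.
have H1 : r * (k ^ 2)%:R <= target k * (k ^ 2)%:R by rewrite ler_wpM2r.
rewrite mul0r addr0.
have : 0 <= r * (k0 ^ 2)%:R by rewrite mulr_ge0.
by have := k_ge0 k; lra.
Qed.

Lemma dens_ge n : p * n%:R <= (dens n)%:R + 7 * ((blk n)%:R + 1).
Proof.
have /andP[H1 H2] := blk_bounds n.
have U := @upto_ge p 0 (blk n) p_ge0 p1 (leq0n _) (fun j _ => target_ge j).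
rewrite densE natrD.
have N : n%:R <= (blk n ^ 2)%:R + (2 * (blk n)%:R + 1) :> R.
  by rewrite -dbl -natrD ler_nat -sqnS ltnW.
have := ler_wpM2l p_ge0 N; have := p_dbl (blk n) p1.
have X0 : 0 <= (included (blk n) * (n - blk n ^ 2))%:R :> R by [].
rewrite exp0n// subr0 in U; have := k_ge0 (blk n); lra.
Qed.

(* The phases start at [k0 = 2^(2^j)], where [trunc_log 2 (trunc_log 2 k)] jumps. *)
Let phase (N : nat) (b : bool) : exists2 k0, (N <= k0)%N &
  forall k, (k0 <= k < k0 ^ 2)%N -> target k = if b then q else p.
Proof.
pose j := (N.*2 + b)%N.
have jodd : odd j = b by rewrite oddD odd_double; case: b @j.
exists (2 ^ (2 ^ j))%N.
  apply: leq_trans (ltnW (ltn_expl _ _)) => //; apply: leq_trans (ltnW (ltn_expl _ _)) => //.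
  by rewrite /j -addnn -addnA leq_addr.
move=> k /andP[H1 H2]; rewrite /target.
suff -> : trunc_log 2 (trunc_log 2 k) = j by rewrite jodd.
have k_gt0 : (0 < k)%N by apply: leq_trans H1; rewrite expn_gt0.
apply: trunc_log_eq => //; apply/andP; split.
  by apply: trunc_log_max.
rewrite -(ltn_exp2l _ _ (ltnSn 1)) (leq_ltn_trans (trunc_logP _ _))//.
by rewrite expnS mulnC expnM.
Qed.

(** At the end [n = k0^4] of a phase with target [q], the positions before the phase are only
    [k0^2 = blk n] in number. *)
Lemma dens_frequently_ge N : exists2 n, (N <= n)%N &
  q * n%:R <= (dens n)%:R + 7 * ((blk n)%:R + 1).
Proof.
have [k0 Nk0 Hk] := phase N true; exists ((k0 ^ 2) ^ 2)%N.
  by apply: leq_trans Nk0 _; apply: leq_trans (leq_sqn k0) (leq_sqn _).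
have le0 := leq_sqn k0.
have U := @upto_ge q k0 (k0 ^ 2)%N q0 q_le1 le0.
have {}U : q * ((k0 ^ 2) ^ 2)%:R - q * (k0 ^ 2)%:R <=
    (included_upto (k0 ^ 2))%:R + 5 * (k0 ^ 2)%:R + 2.
  by rewrite -mulrBr; apply: U => j /Hk ->.
rewrite densE blk_sq subnn muln0 addn0.
have : q * (k0 ^ 2)%:R <= (k0 ^ 2)%:R by rewrite ler_piMl.
by have := sq_ge0 k0; lra.
Qed.

Lemma dens_frequently_le N : exists2 n, (N <= n)%N &
  (dens n)%:R <= p * n%:R + 7 * ((blk n)%:R + 1).
Proof.
have [k0 Nk0 Hk] := phase N false; exists ((k0 ^ 2) ^ 2)%N.
  by apply: leq_trans Nk0 _; apply: leq_trans (leq_sqn k0) (leq_sqn _).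
have le0 := leq_sqn k0.
rewrite densE blk_sq subnn muln0 addn0.
have L k : (k0 <= k <= k0 ^ 2)%N -> (included_upto k)%:R <= (k0 ^ 2)%:R + p * (k ^ 2)%:R :> R.
  elim: k => [|k IH]; first by move=> _ /=; rewrite addr_ge0// mulr_ge0.
  rewrite leq_eqVlt => /andP[/predU1P[<- _|]].
    by rewrite (le_trans (_ : _ <= (k0 ^ 2)%:R)) ?ler_nat ?upto_le_sq// lerDl mulr_ge0.
  rewrite ltnS => k0k kk; have {}IH := IH _.
  have tk : target k = p by rewrite Hk// k0k.
  rewrite included_uptoS natrD natrM sqS; have P2 : 0 <= p * (2 * k%:R + 1).
    by rewrite mulr_ge0// addr_ge0// mulr_ge0.
  have [/includedP H|_] := boolP (included k).
    by rewrite mul1r dbl; rewrite tk in H; have := k_ge0 k; have := sq_ge0 k0; lra.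
  by rewrite mul0r addr0; have := IH; rewrite k0k (ltnW kk) => /(_ isT); lra.
have := L (k0 ^ 2)%N; rewrite le0 leqnn => /(_ isT).
by have := sq_ge0 k0; lra.
Qed.

Lemma sublinear_blk (C : R) : 0 <= C -> sublinear (fun n => C * ((blk n)%:R + 1) : R).
Proof.
move=> C0; apply: sublinearZ => // e e0.
pose c := 2 / e; have c0 : 0 < c by rewrite divr_gt0.
exists (Num.truncn ((c + 2) / e)).+1 => n Hn.
have nlt : (c + 2) / e < n%:R.
  by apply: lt_le_trans (truncnS_gt _) _; rewrite ler_nat.
have /andP[H1 _] := blk_bounds n.
have [kc|ck] := lerP (blk n)%:R (c + 1).
  by rewrite ltr_pdivrMr// in nlt; lra.
have : (blk n ^ 2)%:R <= n%:R :> R by rewrite ler_nat.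
rewrite natrX expr2 => H; apply: le_trans (_ : e * ((blk n)%:R * (blk n)%:R) <= _); last first.
  by rewrite ler_pM2l.
have : 2 * (blk n)%:R <= e * (blk n)%:R * (blk n)%:R.
  rewrite ler_wpM2r// -ler_pdivrMl// mulrC -/c; lra.
by rewrite mulrA; lra.
Qed.

End Density.

(** * The mass of the block construction, and the betting argument *)

Section BlockMass.
Context {R : realType} {K : nat}.
Hypothesis hK : (2 <= K)%N.
Local Notation T := (full_shift R K).
Local Notation A := ('I_K * 'I_K)%type.
Local Notation k := (K%:R : R).
Implicit Types (z : T * T) (s t : seq A).
Variables (p q : R).
Hypotheses (p_ge0 : 0 <= p) (p_le_q : p <= q) (q_le1 : q <= 1).

Let k0 : 0 < k. Proof. exact: K_gt0. Qed.
Let kn0 : k != 0. Proof. by rewrite gt_eqF. Qed.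
Let k2 : 2 <= k. Proof. by rewrite ler_nat. Qed.
Let kk0 : 0 < k * k - k. Proof. by rewrite subr_gt0 ltr_pMl//; have := k2; lra. Qed.

(* When [q = 1], the excluded blocks carry forced disagreements instead of free
   letters, and the free squares alone provide the diverging entropy. *)
Definition free i := is_square i || ~~ included p q (blk i) && (q < 1).

(** [ordS] is the cyclic successor: a disagreement, as [K >= 2], that leaves a single free
    letter. *)
Definition letter_mass (i : nat) (a : A) : R :=
  if free i then (k * k)^-1
  else if included p q (blk i) then (if a.1 == a.2 then k^-1 else 0)
  else (if a.2 == ordS a.1 then k^-1 else 0).

Fixpoint mass s : R := if s is a :: s' then letter_mass (size s') a * mass s' else 1.

Lemma letter_mass_ge0 i a : 0 <= letter_mass i a.
Proof.
rewrite /letter_mass; case: ifP => _; first by rewrite invr_ge0 mulr_ge0 ?(ltW k0).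
by case: ifP => _; case: ifP => _; rewrite ?invr_ge0 ?(ltW k0).
Qed.

Lemma sum_letter_mass i : \sum_a letter_mass i a = 1.
Proof.
rewrite /letter_mass; case: (free i).
  rewrite (eq_bigr (fun a : A => if a.1 == a.2 then (k * k)^-1 else (k * k)^-1)).
    by rewrite sum_pairs -mulrDl addrC subrK mulfV ?mulf_neq0.
  by move=> a _; case: ifP.
case: (included p q (blk i)); first by rewrite sum_pairs mulr0 addr0 mulfV.
rewrite -(pair_bigA _ (fun i j : 'I_K => if j == ordS i then k^-1 else 0))/=.
rewrite (eq_bigr (fun=> k^-1)).
  by rewrite sumr_const card_ord -[LHS]mulr_natl mulfV.
by move=> x _; rewrite -big_mkcond/= big_pred1_eq.
Qed.

Lemma mass_ge0 s : 0 <= mass s.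
Proof. by elim: s => //= a s IH; rewrite mulr_ge0 ?letter_mass_ge0. Qed.

Lemma mass_sum s : \sum_a mass (a :: s) = mass s.
Proof. by rewrite /= -mulr_suml sum_letter_mass mul1r. Qed.

Definition constrained n : nat := (\sum_(0 <= i < n) ~~ free i)%N.

Lemma mass_le s : mass s * k ^+ (2 * size s) <= k ^+ constrained (size s).
Proof.
elim: s => [|a s IH]; first by rewrite /constrained big_nil/= mul1r.
rewrite /= /constrained big_nat_recr//= -/(constrained _) mulnS exprD exprD.
rewrite [leRHS]mulrC mulrACA ler_pM//.
- by rewrite mulr_ge0 ?letter_mass_ge0 ?exprn_ge0 ?(ltW k0).
- by rewrite mulr_ge0 ?mass_ge0 ?exprn_ge0 ?(ltW k0).
rewrite /letter_mass expr2; case: (free _) => /=; first by rewrite mulVf ?mulf_neq0.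
by rewrite expr1; do 2 case: ifP => _; rewrite ?mul0r ?(ltW k0)// mulKf.
Qed.

(** For [q < 1] constrained positions lie in included blocks. For [q = 1] they are all the
    non-squares, and at least [blk n] squares lie below [n]. *)
Lemma constrained_le n : (constrained n)%:R <= Num.max 0 (q * n%:R - (blk n)%:R) :> R.
Proof.
have [q1|q1] := ltP q 1.
  apply: le_trans (dens_le p_ge0 p_le_q n); rewrite ler_nat.
  by apply: leq_sum => i _; rewrite /free q1 andbT negb_or negbK; case: is_square.
have -> : q = 1 by apply/eqP; rewrite eq_le q_le1.
rewrite mul1r -natrB; last by have /andP[H _] := blk_bounds n; apply: leq_trans H; exact: leq_sqn.
rewrite le_max; apply/orP; right; rewrite ler_nat.
have H : (constrained n + \sum_(0 <= i < n) is_square i = n)%N.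
  rewrite -big_split/= (eq_bigr (fun=> 1%N)) ?sum_nat_const_nat ?subn0 ?muln1// => i _.
  by rewrite /free ltNge q1 andbF orbF; case: is_square.
have S := sum_squares n.
rewrite -[X in (_ <= X - _)%N]H leq_subRL.
  rewrite addnC leq_add2l -ltnS -S -[leqRHS]addn1 leq_add2l; exact: leq_b1.
rewrite H; have /andP[H' _] := blk_bounds n; apply: leq_trans H'; exact: leq_sqn.
Qed.

Lemma powR_exprV n (s : R) : (k ^- n) `^ s = k `^ (- (n%:R * s)).
Proof. by rewrite -powR_mulrn ?(ltW k0)// -powRN -powRrM mulNr. Qed.

Lemma mass_le_pow g (n : nat) t : size t = n -> g%:R + (constrained n)%:R <= q * n%:R ->
  k ^+ g * mass t <= (k ^- n) `^ (2 - q).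
Proof.
move=> st H; rewrite powR_exprV.
have k2n : 0 < k ^+ (2 * n) by rewrite exprn_gt0.
rewrite -(ler_pM2r k2n) -mulrA.
have := mass_le t; rewrite st => /(ler_wpM2l (exprn_ge0 g (ltW k0))) /le_trans; apply.
rewrite -exprD -!powR_mulrn ?(ltW k0)// -powRD ?kn0 ?implybT//.
by apply: ler_powR; [have := k2; lra|rewrite natrD natrM; lra].
Qed.

Lemma mass_le_pow0 t : q = 0 -> mass t <= (k ^- size t) `^ (2 - q).
Proof.
move=> q0; rewrite -[leLHS]mul1r -(expr0 k); apply: mass_le_pow => //.
have := constrained_le (size t); rewrite q0 !mul0r sub0r add0r => /le_trans; apply.
by rewrite ge_max lexx/= oppr_le0.
Qed.

(** The deficit [blk n] in [constrained_le] diverges and so pays for any factor [k^g]. *)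
Lemma mass_le_pow_large g : 0 < q -> exists n0, forall t, (n0 <= size t)%N ->
  k ^+ g * mass t <= (k ^- size t) `^ (2 - q).
Proof.
move=> q0; have [N HN] := @sublinear_blk R 1 ler01 q q0.
exists (maxn N (g ^ 2)) => t; rewrite geq_max => /andP[/HN Nt gt].
apply: mass_le_pow => //; rewrite mul1r in Nt.
have := constrained_le (size t); rewrite (max_idPr _); last by lra.
have : g%:R <= (blk (size t))%:R :> R by rewrite ler_nat blk_id_ge.
lra.
Qed.

(* After a run of [L] agreements the gambler bets that a free position continues
   it. Losses are rare since they end disjoint runs of length [L]; so if the fortune
   [bet / mass] stays bounded, then so do the wins, up to [4 / L] per position. *)
Definition letter_bet (L r i : nat) (a : A) : R :=
  if (r == L) && free i then (if a.1 == a.2 then 3 / 4 / k else 1 / 4 / (k * k - k))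
  else letter_mass i a.

Fixpoint bet L s : R :=
  if s is a :: s' then letter_bet L (run L s') (size s') a * bet L s' else 1.

Lemma letter_bet_ge0 L r i a : 0 <= letter_bet L r i a.
Proof.
rewrite /letter_bet; case: ifP => _; last exact: letter_mass_ge0.
by case: ifP => _; rewrite !mulr_ge0// invr_ge0 ltW.
Qed.

Lemma bet_ge0 L s : 0 <= bet L s.
Proof. by elim: s => //= a s IH; rewrite mulr_ge0 ?letter_bet_ge0. Qed.

Lemma bet_submass L : submass (EFin \o bet L).
Proof.
apply: submass_EFin => s; first exact: bet_ge0.
rewrite /= -mulr_suml ler_piMl ?bet_ge0// /letter_bet; case: (_ && _); last first.
  by rewrite sum_letter_mass.
rewrite sum_pairs mulrCA mulfV// mulrCA mulfV ?gt_eqF//; lra.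
Qed.

Let wins L z n : nat :=
  (\sum_(0 <= i < n) ((run L (pre (pairs z) i) == L) && (free i && agree z i)))%N.
Let losses L z n : nat :=
  (\sum_(0 <= i < n) ((run L (pre (pairs z) i) == L) && (free i && ~~ agree z i)))%N.

(** A win multiplies [bet / mass] by [3 * k / 4 >= 3 / 2], and a loss by at least [1 / 4]. *)
Let bet_ge L z n :
  mass (pre (pairs z) n) * (3 / 2) ^+ wins L z n <= bet L (pre (pairs z) n) * 4 ^+ losses L z n.
Proof.
elim: n => [|n IH]; first by rewrite /wins /losses !big_nil /= !mulr1.
rewrite /wins /losses !big_nat_recr//= -/(wins L z n) -/(losses L z n).
rewrite [(wins L z n + _)%N]addnC [(losses L z n + _)%N]addnC !exprD.
rewrite size_pre [leLHS]mulrACA [leRHS]mulrACA ler_pM//.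
- by rewrite mulr_ge0 ?letter_mass_ge0// exprn_ge0//; lra.
- by rewrite mulr_ge0 ?mass_ge0// exprn_ge0//; lra.
rewrite /letter_bet -/(agree z n); case: (_ == L) => /=; last by [].
rewrite /letter_mass; case: (free n) => /=; last by [].
case: (agree z n) => /=; rewrite ?expr1 ?expr0 ?mulr1.
  rewrite invfM [leRHS]mulrC -mulrA ler_pM2l ?invr_gt0//.
  have : k^-1 <= 2^-1 by rewrite lef_pV2 ?posrE//.
  lra.
rewrite mulrAC -[1 / 4 * 4]/(1 / 4 * 4 : R).
have -> : 1 / 4 * 4 = 1 :> R by lra.
rewrite mul1r lef_pV2 ?posrE ?mulr_gt0//; have := k0; lra.
Qed.

(** The current run is a reserve: it grows by at most 1 per step, and a loss spends [L] of it. *)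
Let losses_le L z n : (L * losses L z n + run L (pre (pairs z) n) <= n)%N.
Proof.
elim: n => [|n IH]; first by rewrite /losses big_nil /= muln0.
rewrite /losses big_nat_recr//= -/(losses L z n) -/(agree z n) mulnDr.
case: (agree z n); rewrite ?andbF ?muln0 ?addn0 ?andbT.
  apply: leq_trans (_ : _ <= (L * losses L z n + run L (pre (pairs z) n)).+1)%N _ => //.
  by rewrite -addnS leq_add2l geq_minr.
apply: leq_trans (leqW IH); rewrite leq_add2l.
have [->|_] := eqVneq (run L (pre (pairs z) n)) L; last by rewrite muln0.
by rewrite -[leqRHS]muln1 leq_mul2l leq_b1 orbT.
Qed.

Let wins_le L z C : (forall n, 0 < mass (pre (pairs z) n)) ->
  (forall n, bet L (pre (pairs z) n) <= C * mass (pre (pairs z) n)) ->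
  exists c, forall n, (L * wins L z n <= 4 * n + c)%N.
Proof.
move=> mp HC.
have [c Cc] : exists c, C <= (3 / 2) ^+ c.
  pose c := (Num.truncn (Num.max C 0)).+1.*2; exists c.
  have H : C <= c%:R / 2.
    apply: le_trans (_ : Num.max C 0 <= _); first by rewrite le_max lexx.
    apply: ltW; apply: lt_le_trans (truncnS_gt _) _.
    by rewrite /c -muln2 natrM mulfK.
  apply: (le_trans H); elim: (c) => [|m IH]; first by rewrite mul0r exprn_ge0.
  have B : 1 <= (3 / 2 : R) ^+ m by rewrite exprn_ege1//; lra.
  rewrite exprS -natr1; lra.
exists (L * c)%N => n.
(* Four wins make up for one loss, whence the 4 in the bound. *)
have H4 : (4 : R) <= (3 / 2) ^+ 4 by rewrite !exprS expr0; lra.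
have W : (wins L z n <= 4 * losses L z n + c)%N.
  rewrite -(@ler_eXn2l _ (3 / 2 : R)); last by lra.
  rewrite exprD exprM -(ler_pM2l (mp n)).
  apply: (le_trans (bet_ge L z n)).
  apply: (@le_trans _ _ (C * mass (pre (pairs z) n) * 4 ^+ losses L z n)).
    by rewrite ler_wpM2r// exprn_ge0.
  rewrite [C * _]mulrC -mulrA ler_pM2l// mulrC; apply: ler_pM => //.
  - rewrite -(pmulr_lge0 _ (mp n)); apply: le_trans (HC n); exact: bet_ge0.
  - by rewrite lerXn2r// nnegrE ?exprn_ge0//; lra.
apply: leq_trans (leq_mul (leqnn L) W) _; rewrite mulnDr leq_add2r mulnCA leq_mul2l/=.
by apply: leq_trans (losses_le L z n); rewrite leq_addr.
Qed.

Lemma mass_gt0_letter z i : (forall n, 0 < mass (pre (pairs z) n)) -> ~~ free i ->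
  agree z i = included p q (blk i).
Proof.
move=> /(_ i.+1)/= + /negbTE fi; rewrite size_pre /letter_mass fi /agree.
have [_|_] := boolP (included p q (blk i)).
  by case: ifP => //; rewrite mul0r ltxx.
case: (eqVneq (pairs z i).2 _) => [E _|_]; last by rewrite mul0r ltxx.
rewrite [LHS](_ : _ = ((pairs z i).1 == (pairs z i).2))// E -val_eqE /=.
case: (z.1 i) => x xK /=.
have [Ex|nx] := eqVneq x.+1 K.
  by rewrite Ex modnn; apply/eqP => x0; move: Ex hK; rewrite x0 => <-.
rewrite modn_small; last by rewrite ltn_neqAle nx.
by rewrite ltn_eqF.
Qed.

(** A position of an included block starts a window unless it is a square or the block index changes
    within distance [L]; both exceptions are controlled by [blk n]. *)
Lemma windows_ge z L n : (forall n, 0 < mass (pre (pairs z) n)) ->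
  (dens p q n)%:R <= (windows z L n)%:R + (1 + L + L * L)%:R * ((blk n)%:R + 1) :> R.
Proof.
move=> mp; rewrite -[1]/(1%:R) -natrD -natrM -natrD ler_nat.
have H : (dens p q n <= windows z L n + \sum_(0 <= i < n) is_square i +
    \sum_(0 <= i < n) (blk (i + L) != blk i))%N.
  rewrite -!big_split/=; apply: leq_sum => i _.
  have [inc|//] := boolP (included p q (blk i)).
  have [//|nsq] := boolP (is_square i); first by rewrite addn1 addSn.
  have [same|] := eqVneq (blk (i + L)) (blk i); last by rewrite addn1.
  suff -> : window z L i by [].
  apply/windowP => j jL.
  have bj : blk (i + j) = blk i.
    apply/eqP; rewrite eqn_leq; apply/andP; split; last by apply: leq_blk; exact: leq_addr.
    by rewrite -same; apply: leq_blk; rewrite leq_add2l ltnW.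
  rewrite mass_gt0_letter ?bj// /free bj inc/= orbF.
  apply: contra nsq; rewrite /is_square bj => /eqP E.
  have /andP[H _] := blk_bounds i; rewrite eqn_leq H/= E leq_addr//.
apply: leq_trans H _; rewrite -addnA leq_add2l.
have S := sum_squares n; have C := blk_change L n.
have {}S : (\sum_(0 <= i < n) is_square i <= (blk n).+1)%N by rewrite -S leq_addr.
apply: leq_trans (leq_add S C) _.
rewrite addn1 2!mulnDl mul1n -addnA leq_add2l mulnDr leq_add//.
  by rewrite leq_mul2l leqnSn orbT.
by rewrite leq_pmulr.
Qed.

Lemma windows_le_gap z L n : q = 1 -> (0 < L)%N -> (forall n, 0 < mass (pre (pairs z) n)) ->
  (windows z L n)%:R <= (dens p q n)%:R + ((blk n)%:R + 1) :> R.
Proof.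
move=> q1 L0 mp; rewrite -[1]/(1%:R) -!natrD ler_nat.
have S := sum_squares n.
apply: (@leq_trans (dens p q n + \sum_(0 <= i < n) is_square i)%N); last first.
  by rewrite leq_add2l addn1 -S leq_addr.
rewrite -big_split/=; apply: leq_sum => i _.
have [/windowP/(_ 0 L0)|//] := boolP (window z L i); rewrite addn0 => ag.
have [sq|nsq] := boolP (is_square i); first by rewrite addn1.
by rewrite -(mass_gt0_letter mp) ?ag// /free (negbTE nsq) q1 ltxx andbF.
Qed.

(** A window of length [L.+1] is a full run followed by an agreement, which is either a win or lies
    in an included block. *)
Lemma windows_le_bet z L C : q < 1 -> (0 < L)%N -> (forall n, 0 < mass (pre (pairs z) n)) ->
  (forall n, bet L (pre (pairs z) n) <= C * mass (pre (pairs z) n)) ->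
  exists2 c : R, 0 <= c & forall n,
    (windows z L.+1 n)%:R <= (dens p q n)%:R + 4 / L%:R * n%:R + c.
Proof.
move=> q1 L0 mp HC; have [c Hc] := wins_le mp HC.
have LR : 0 < L%:R :> R by rewrite ltr0n.
exists (L%:R + (4 * L + c)%:R / L%:R) => [|n]; first by rewrite addr_ge0// divr_ge0.
have H : (windows z L.+1 n <= wins L z (n + L) + (dens p q n + L))%N.
  have -> : windows z L.+1 n = (\sum_(0 <= i < n + L)
      ((run L (pre (pairs z) i) == L) && agree z i))%N.
    by rewrite sum_run_max; apply: eq_bigr => i _; rewrite windowS.
  apply: (@leq_trans (wins L z (n + L) + dens p q (n + L))%N).
    rewrite -big_split/=; apply: leq_sum => i _; case: (_ == L) => //=.
    have [fr|nf] := boolP (free i); first by rewrite leq_addr.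
    by rewrite mass_gt0_letter.
  rewrite leq_add2l /dens (big_cat_nat (leq0n n) (leq_addr L n))/= leq_add2l.
  rewrite -{2}(addKn n L) -[leqRHS]muln1 -sum_nat_const_nat; apply: leq_sum => i _.
  exact: leq_b1.
have : (windows z L.+1 n)%:R <= (wins L z (n + L))%:R + ((dens p q n)%:R + L%:R) :> R.
  by rewrite -!natrD ler_nat.
have : (wins L z (n + L))%:R <= 4 / L%:R * n%:R + (4 * L + c)%:R / L%:R :> R.
  rewrite mulrAC -mulrDl ler_pdivlMr// -natrM -natrM -natrD ler_nat mulnC addnA -mulnDr.
  exact: Hc.
lra.
Qed.

End BlockMass.

(** * Typical pairs lie in the sets E, and in D when [q = 1] *)

Section TypicalPairs.
Context {R : realType} {K : nat}.
Hypothesis hK : (2 <= K)%N.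
Local Notation T := (full_shift R K).
Local Notation k := (K%:R : R).
Variables (p q : R).
Hypotheses (p_ge0 : 0 <= p) (p_le_q : p <= q) (q_le1 : q <= 1).

Definition typical (z : T * T) :=
  (forall n, 0 < mass p q (pre (pairs z) n) :> R) /\
  forall j, exists C : R, forall n,
    bet p q j.+1 (pre (pairs z) n) <= C * mass p q (pre (pairs z) n).

(** For [q = 1] disagreement is forced on excluded blocks outside the squares, so there is no
    surplus at all; this gives the exact values required by [D_set]. *)
Definition defect (L : nat) : R := if q < 1 then 4 / L%:R else 0.

Let defect_ge0 L : 0 <= defect L.
Proof. by rewrite /defect; case: ifP => // _; rewrite divr_ge0. Qed.

Lemma typical_dist (z : T * T) L e : typical z -> (0 < L)%N -> 0 < e <= k ^- L ->
  q <= upper_dist (@shift_map R K) z.1 z.2 e <= q + defect L /\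
  p <= lower_dist (@shift_map R K) z.1 z.2 e <= p + defect L.
Proof.
move=> [mp bets] L0 /andP[e0 eL].
(* As [K^-M < e <= K^-L], the count at scale [e] lies between those of the windows of lengths [M.+1]
   and [L.+1]. *)
have [M Me] := expr_inv_small hK e0.
have [c c0 Hc] : exists2 c : R, 0 <= c & forall n,
    (windows z L.+1 n)%:R <= (dens p q n)%:R + defect L * n%:R + c * ((blk n)%:R + 1).
  have [q1|q1] := ltP q 1.
    case: L L0 {eL} => // j _; have [C HC] := bets j.
    have [c c0 Hc] := windows_le_bet hK q1 (ltn0Sn j) mp HC.
    exists c => // n; rewrite /defect q1; apply: le_trans (Hc n) _.
    by rewrite lerD2l ler_peMr// lerDr.
  exists 1 => // n; rewrite /defect ltNge q1/= mul0r addr0 mul1r.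
  apply: windows_le_gap => //; apply/eqP; by rewrite eq_le q_le1.
pose C : R := 7 + (1 + M.+1 + M.+1 * M.+1)%:R + c.
have C0 : 0 <= C by rewrite addr_ge0// addr_ge0.
pose b n : R := C * ((blk n)%:R + 1).
have bE n : b n = 7 * ((blk n)%:R + 1) + (1 + M.+1 + M.+1 * M.+1)%:R * ((blk n)%:R + 1)
    + c * ((blk n)%:R + 1) by rewrite /b /C; ring.
have t0 n : 0 <= (blk n)%:R + 1 :> R by rewrite addr_ge0.
have b1 n : 0 <= 7 * ((blk n)%:R + 1) :> R by rewrite mulr_ge0.
have b2 n : 0 <= (1 + M.+1 + M.+1 * M.+1)%:R * ((blk n)%:R + 1) :> R by rewrite mulr_ge0.
have b3 n : 0 <= c * ((blk n)%:R + 1) :> R by rewrite mulr_ge0.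
have q0 : 0 <= q by exact: le_trans p_le_q.
rewrite /upper_dist /lower_dist.
have -> : prox_freq (@shift_map R K) z.1 z.2 e = (fun n => (proximal z e n)%:R / n%:R).
  by apply/funext => n; rewrite prox_freqE.
apply: (@density_bounds _ p q (defect L) (proximal z e) (fun n => (dens p q n)%:R) b).
- exact: defect_ge0.
- exact: sublinear_blk.
- exact: proximal_le.
- move=> n; apply: le_trans (dens_le p_ge0 p_le_q n) _.
  have qn0 : 0 <= q * n%:R by rewrite mulr_ge0.
  have bn0 : 0 <= (blk n)%:R :> R by [].
  rewrite bE; have := b1 n; have := b2 n; have := b3 n => ? ? ?.
  by rewrite ge_max; apply/andP; split; lra.
- move=> n; apply: le_trans (dens_ge p_ge0 p_le_q q_le1 n) _.
  by rewrite bE; have := b1 n; have := b2 n; have := b3 n; lra.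
- move=> N; have [n Nn H] := dens_frequently_ge p_ge0 p_le_q q_le1 N; exists n => //.
  by apply: le_trans H _; rewrite bE; have := b1 n; have := b2 n; have := b3 n; lra.
- move=> N; have [n Nn H] := dens_frequently_le q p_ge0 N; exists n => //.
  by apply: le_trans H _; rewrite bE; have := b1 n; have := b2 n; have := b3 n; lra.
- move=> n; apply: le_trans (_ : (windows z L.+1 n)%:R <= _).
    by rewrite ler_nat -(proximalE hK) proximal_mono.
  by apply: le_trans (Hc n) _; rewrite bE; have := b1 n; have := b2 n; lra.
- move=> n; apply: le_trans (windows_ge hK M.+1 n mp) _.
  apply: lerD; last by rewrite bE; have := b1 n; have := b3 n; lra.
  by rewrite ler_nat -(proximalE hK) proximal_mono// ltW.
Qed.

Let small L : 0 < k ^- L.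
Proof. by rewrite invr_gt0 exprn_gt0// K_gt0. Qed.

Lemma typical_E (z : T * T) : typical z -> E_set (@shift_map R K) p q z.
Proof.
move=> tz.
have near_defect (F : R -> R) (r : R) :
    (forall L e, (0 < L)%N -> 0 < e <= k ^- L -> r <= F e <= r + defect L) ->
    F e @[e --> 0^'+] --> r.
  move=> H; apply/cvgrPdist_le => /= eps eps0.
  pose L := (Num.truncn (4 / eps)).+1.
  have dL : defect L <= eps.
    rewrite /defect; case: ifP => _; last exact: ltW.
    by rewrite ler_pdivrMr ?ltr0n// mulrC -ler_pdivrMr// ltW// truncnS_gt.
  near=> e.
  have /andP[Hl Hu] : r <= F e <= r + defect L.
    apply: H => //; apply/andP; split; near: e; first exact: nbhs_right_gt.
    by apply: nbhs_right_le; exact: small.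
  by rewrite distrC ger0_norm ?subr_ge0// lerBlDl (le_trans Hu)// lerD2l.
split; apply: near_defect => L e L0 eL; first by have [] := typical_dist tz L0 eL.
by have [] := typical_dist tz L0 eL.
Unshelve. all: by end_near. Qed.

Lemma typical_D (z : T * T) : q = 1 -> typical z -> D_set (@shift_map R K) p q z.
Proof.
move=> q1 tz; exists (k ^- 1) => [|e He]; first exact: small.
have := typical_dist tz (ltn0Sn 0) He; rewrite /defect q1 ltxx !addr0.
by case=> /le_anti <- /le_anti <-.
Qed.

Lemma hausdorff_measure_ge_typical (G : R) (X : set (T * T)) n0 : 0 < G ->
  (forall t : seq ('I_K * 'I_K), (n0 <= size t)%N -> G * mass p q t <= (k ^- size t) `^ (2 - q)) ->
  typical `<=` X -> (G%:E <= hausdorff_measure (2 - q) X)%E.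
Proof.
move=> G0 HG HX.
apply: (@hausdorff_measure_ge_mass _ _ hK (mass p q) _ _ _ _ (fun j => bet p q j.+1) X n0) => //.
- by move=> t; exact: mass_ge0.
- by move=> t; exact: mass_sum.
- by have := q_le1; lra.
- by move=> j; exact: bet_submass.
- by move=> z mp bets; apply: HX.
Qed.

Lemma hausdorff_measure_typical_pinfty (X : set (T * T)) : 0 < q -> typical `<=` X ->
  hausdorff_measure (2 - q) X = +oo%E.
Proof.
move=> q0 HX; apply/eqyP => r _.
pose g := (Num.truncn (Num.max r 0)).+1.
have [n0 Hn0] := mass_le_pow_large hK p_ge0 p_le_q q_le1 g q0.
apply: le_trans (_ : ((k ^+ g)%:E <= _)%E); last first.
  by apply: hausdorff_measure_ge_typical Hn0 HX; rewrite exprn_gt0// K_gt0.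
rewrite lee_fin; apply: (@le_trans _ _ g%:R).
  by apply: ltW; apply: le_lt_trans (truncnS_gt _); rewrite le_max lexx.
by rewrite -natrX ler_nat ltnW// ltn_expl.
Qed.

(** The uniform mass of a cylinder of length [n] is exactly [(K^-n)^2], so the whole space has
    measure at most 1. *)
Lemma hausdorff_measure_le1 (X : set (T * T)) : (hausdorff_measure 2 X <= 1)%E.
Proof.
have k0 : 0 < k by exact: K_gt0.
rewrite -[1%E]/(1%:E) -[1 in leRHS]invr1.
apply: (@hausdorff_measure_le_submass _ _ hK _ _ (fun t => (k ^- (2 * size t))%:E)) => //.
  apply: submass_EFin => t /=; first by rewrite invr_ge0 exprn_ge0// ltW.
  rewrite sumr_const card_prod card_ord -[leLHS]mulr_natl mulnS exprD natrM invfM.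
  by rewrite mulrA expr2 mulfV ?mul1r// mulf_neq0// gt_eqF.
  by rewrite /= muln0 expr0 invr1.
move=> z _ n0; exists n0 => //.
rewrite size_pre mul1r lee_fin -[2%R]/(2%:R).
rewrite powR_mulrn ?invr_ge0 ?exprn_ge0 ?(ltW k0)//.
by rewrite -exprVn -exprM mulnC exprVn.
Qed.

End TypicalPairs.

Theorem theorem1p1 (R : realType) (K : nat) (p q : R) (hK : (2 <= K)%N)
    (hp : 0 <= p) (hpq : p <= q) (hq : q <= 1) :
  hausdorff_measure (2 - q) (E_set (@shift_map R K) p q) =
    (if q == 0 then 1%E else +oo%E) /\
  hausdorff_measure (2 - q) (D_set (@shift_map R K) p q) =
    (if q < 1 then 0%E else +oo%E).
Proof.
have q0 : 0 <= q := le_trans hp hpq.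
split.
  have [q00|qn0] := eqVneq q 0.
    apply/eqP; rewrite eq_le; apply/andP; split.
      by rewrite q00 subr0; exact: hausdorff_measure_le1.
    apply: (hausdorff_measure_ge_typical (n0 := 0) hK hq ltr01).
      by move=> t _; rewrite mul1r; exact: (mass_le_pow0 hK hp hpq hq).
    by move=> z; exact: typical_E.
  apply: (hausdorff_measure_typical_pinfty hK hp hpq hq); first by rewrite lt_neqAle eq_sym qn0.
  by move=> z; exact: typical_E.
have [q1|q1] := ltP q 1; first by apply: hausdorff_D_set_eq0; rewrite ?q0.
have {}q1 : q = 1 by apply/eqP; rewrite eq_le hq.
apply: (hausdorff_measure_typical_pinfty hK hp hpq hq); first by rewrite q1.
by move=> z; exact: typical_D.
Qed.
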